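(* Let $D\in\{\mathbb{D},\mathbb{H}\}$ and $\tau\in\partial D$. Suppose that $(w_{s,t})_{(s,t)\in\Delta(I)}\subset\mathfrak{U}_\tau$ satisfies $w_{s,s}=\mathrm{id}_D$ for any $s\in I$, and $w_{s,u}=w_{t,u}\circ w_{s,t}$ for any $s,t,u\in I$ with $s\le t\le u$. If there exists $z_0\in D$ such that the map $I\ni t\mapsto w_{0,t}(z_0)$ belongs to $AC_{\mathrm{loc}}(I)$, then $(w_{s,t})$ is an absolutely continuous evolution family.
   Context: $\mathbb{D}:=\{z\colon|z|<1\}$, $\mathbb{H}:=\{z\colon\operatorname{Re}z>0\}$; the boundary $\partial\mathbb{H}$ is taken in the Riemann sphere, so $\infty\in\partial\mathbb{H}$. $\mathsf{Hol}(D,D)$ is the set of holomorphic self-maps of $D$. Boundary fixed points: $\sigma\in\partial D$ is a boundary fixed point of $w\in\mathsf{Hol}(D,D)$ if the angular limit of $w$ at $\sigma$ equals $\sigma$; it is regular (BRFP) if the angular derivative $w'(\sigma)$ is finite, where $w'(\sigma):=\angle\lim_{z\to\sigma}\frac{w(z)-\sigma}{z-\sigma}$ for $\sigma\ne\infty$; for $\sigma=\infty\in\partial\mathbb{H}$ one puts $w'(\infty):=\angle\lim_{z\to\infty}w(z)/z$ (which always exists in $[0,+\infty)$), and $\infty$ is a BRFP iff $w'(\infty)\ne0$. For $w\in\mathsf{Hol}(D,D)$ without fixed points in $D$, the Denjoy–Wolff point (DW-point) is the unique BRFP $\tau\in\partial D$ with $w'(\tau)\le1$ if $\tau\ne\infty$,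 and $w'(\tau)\ge1$ if $\tau=\infty$. For $\tau\in\partial D$, $\mathfrak{U}_\tau$ denotes the set consisting of $\mathrm{id}_D$ and all $v\in\mathsf{Hol}(D,D)$ for which $\tau$ is the DW-point. $I\subset\mathbb{R}$ is an interval of the form $[0,T]$ with $T\in(0,+\infty)$ or $[0,T)$ with $T\in(0,+\infty]$; $\Delta(I):=\{(s,t)\colon s,t\in I,\ s\le t\}$; $AC_{\mathrm{loc}}(I)$ is the class of real- or complex-valued functions on $I$ absolutely continuous on each compact subinterval of $I$; $L^1_{\mathrm{loc}}(I)$ is the class of measurable functions on $I$ integrable on each compact subinterval. An absolutely continuous evolution family in $D$ over $I$ is a family $(w_{s,t})_{(s,t)\in\Delta(I)}\subset\mathsf{Hol}(D,D)$ such that: EF1: $w_{s,s}=\mathrm{id}_D$ for all $s\in I$; EF2: $w_{s,u}=w_{t,u}\circ w_{s,t}$ whenever $s\le t\le u$ in $I$; EF3: for each $z\in D$ there is a non-negative $f_z\in L^1_{\mathrm{loc}}(I)$ with $|w_{s,u}(z)-w_{s,t}(z)|\le\int_t^u f_z(r)\,\mathrm{d}r$ whenever $s\le t\le u$ in $I$. *)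

(* Defs.v *)
From mathcomp Require Import all_boot all_order all_algebra.
From mathcomp Require Import complex.
From mathcomp Require Import all_classical all_reals all_analysis.

Set Implicit Arguments.
Unset Strict Implicit.
Unset Printing Implicit Defensive.

Import Order.TTheory GRing.Theory Num.Theory.
Import numFieldNormedType.Exports.

Local Open Scope classical_set_scope.
Local Open Scope ring_scope.
Local Open Scope complex_scope.

(* The modulus as a real number; `|z| itself is the element (cmod z)%:C. *)
Definition cmod {R : realType} (z : R[i]) : R := complex.Re `|z|.

(* The Riemann sphere; [None] is the point at infinity. R[i] receives its
   topology through the regular module R[i]^o. *)
Notation sphere R := (one_point_compactification R[i]^o).

Inductive domain := UnitDisk | RightHalfPlane.

Definition dom {R : realType} (D : domain) : set R[i] :=
  match D with
  | UnitDisk => [set z | cmod z < 1]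
  | RightHalfPlane => [set z | 0 < complex.Re z]
  end.

Definition boundary {T : topologicalType} (A : set T) : set T :=
  closure A `\` interior A.

(* The boundary in the sphere, so that it contains [None] when D = H. *)
Definition bdry {R : realType} (D : domain) : set (sphere R) :=
  boundary (Some @` dom D : set (sphere R)).

(* Euclidean distance from a point of D to the finite part of the boundary. *)
Definition bdist {R : realType} (D : domain) (z : R[i]) : R :=
  match D with
  | UnitDisk => 1 - cmod z
  | RightHalfPlane => complex.Re z
  end.

(* Non-tangential (Stolz) region of aperture k at sigma. At infinity in H this
   is the sector |z| < k Re z, i.e. |Arg z| < arccos (1/k) for k > 1. *)
Definition stolz {R : realType} (D : domain) (sigma : sphere R) (k : R) :
    set R[i] :=
  [set z | dom D z /\
           cmod (if sigma is Some s then z - (s : R[i]) else z) < k * bdist D z].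

(* Traces of the neighbourhoods of sigma on the Stolz region. *)
Definition stolz_filter {R : realType} (D : domain) (sigma : sphere R) (k : R) :
    set_system R[i] :=
  filter_from (nbhs sigma)
    (fun V : set (sphere R) => [set z | stolz D sigma k z /\ V (Some z)]).

(* For k too small the Stolz region does not accumulate at sigma and the
   condition is void, so quantifying over all k is harmless. *)
Definition angular_limit {R : realType} {T : topologicalType} (D : domain)
    (sigma : sphere R) (f : R[i] -> T) (l : T) : Prop :=
  forall k : R, f @ stolz_filter D sigma k --> l.

(* Self-maps are represented by total functions whose values outside dom D are
   irrelevant. [derivable f z 1] over the field R[i] is complex
   differentiability at z. *)
Definition Hol {R : realType} (D : domain) (f : R[i] -> R[i]) : Prop :=
  (forall z, dom D z -> dom D (f z)) /\
  (forall z, dom D z -> derivable (f : R[i]^o -> R[i]^o) z 1).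

Definition boundary_fixed_point {R : realType} (D : domain)
    (f : R[i] -> R[i]) (sigma : sphere R) : Prop :=
  bdry D sigma /\
  angular_limit D sigma (fun z => Some (f z) : sphere R) sigma.

Definition angular_derivative {R : realType} (D : domain)
    (f : R[i] -> R[i]) (sigma : sphere R) (l : R[i]) : Prop :=
  match sigma with
  | Some s => angular_limit D sigma (fun z => (f z - (s : R[i])) / (z - (s : R[i])) : R[i]^o) l
  | None => angular_limit D sigma (fun z => f z / z : R[i]^o) l
  end.

(* At infinity the angular derivative always exists, and regularity means that
   it does not vanish. *)
Definition brfp_with {R : realType} (D : domain)
    (f : R[i] -> R[i]) (sigma : sphere R) (l : R[i]) : Prop :=
  [/\ boundary_fixed_point D f sigma,
      angular_derivative D f sigma l &
      (sigma = None -> l != 0)].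

(* In the order of R[i], l <= 1 and 1 <= l mean that l is real and satisfies the
   inequality; angular derivatives at boundary regular fixed points are always
   real. The uniqueness of such a tau is the Denjoy-Wolff theorem. *)
Definition DW_point {R : realType} (D : domain)
    (f : R[i] -> R[i]) (tau : sphere R) : Prop :=
  [/\ Hol D f,
      (forall z, dom D z -> f z <> z) &
      exists l : R[i],
        brfp_with D f tau l /\ (if tau is Some _ then l <= 1 else 1 <= l)].

Definition frakU {R : realType} (D : domain) (tau : sphere R) :
    set (R[i] -> R[i]) :=
  [set f | (forall z, dom D z -> f z = z) \/ DW_point D f tau].

Definition time_interval {R : realType} (I : set R) : Prop :=
  [\/ exists2 T : R, 0 < T & I = `[0, T]%classic,
      exists2 T : R, 0 < T & I = `[0, T[%classic |
      I = `[0, +oo[%classic].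

Definition abs_continuous {R : realType} (a b : R) (g : R -> R[i]) : Prop :=
  forall e : R, 0 < e -> exists2 d : R, 0 < d &
    forall (n : nat) (u v : 'I_n -> R),
      (forall i, [/\ a <= u i, u i <= v i & v i <= b]) ->
      trivIset [set: 'I_n] (fun i => `]u i, v i[%classic) ->
      \sum_i (v i - u i) < d ->
      \sum_i cmod (g (v i) - g (u i)) < e.

Definition AC_loc {R : realType} (I : set R) (g : R -> R[i]) : Prop :=
  forall a b : R, a <= b -> `[a, b] `<=` I -> abs_continuous a b g.

Definition L1_loc {R : realType} (I : set R) (f : R -> R) : Prop :=
  measurable_fun I f /\
  forall a b : R, a <= b -> `[a, b] `<=` I ->
    lebesgue_measure.-integrable `[a, b] (EFin \o f).

(* A family (w_{s,t}) is a total function w; only the w s t with s, t in I,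
   s <= t, are constrained. *)
Definition evolution_laws {R : realType} (D : domain) (I : set R)
    (w : R -> R -> R[i] -> R[i]) : Prop :=
  (forall s, I s -> forall z, dom D z -> w s s z = z) /\
  (forall s t u, I s -> I t -> I u -> s <= t -> t <= u ->
     forall z, dom D z -> w s u z = w t u (w s t z)).

Definition AC_evolution_family {R : realType} (D : domain) (I : set R)
    (w : R -> R -> R[i] -> R[i]) : Prop :=
  [/\ (forall s t, I s -> I t -> s <= t -> Hol D (w s t)),
      evolution_laws D I w &
      (forall z, dom D z ->
         exists f : R -> R,
           [/\ L1_loc I f,
               (forall r, I r -> 0 <= f r) &
               forall s t u, I s -> I t -> I u -> s <= t -> t <= u ->
                 ((cmod (w s u z - w s t z))%:E <=
                  \int[lebesgue_measure]_(r in `[t, u]) (f r)%:E)%E])].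

(* Main.v *)
(* Let T map D onto the right half-plane H and tau to infinity, and let W_(s,t)
   be the conjugate of w_(s,t) by T. By the Julia inequality the maps in U_tau
   become self-maps of H with Re (W z) >= Re z, so for s <= t <= u the function
   h = W_(s,u) - W_(s,t) has a nonnegative real part, and Harnack's inequality
   bounds |h(z)| by |h(a)| times a constant locally uniform in z and a. For
   a = W_(0,s)(T z0) one has h(a) = W_(0,u)(T z0) - W_(0,t)(T z0), which is
   controlled by the variation V of the absolutely continuous path
   t |-> W_(0,t)(T z0). The bound is at most Phi u - Phi t with Phi a cubic
   polynomial in V, hence absolutely continuous and nondecreasing, and
   Radon-Nikodym provides the density.

   Both the Julia and the Harnack inequality follow from the Schwarz-Pick lemma
   in H, i.e. from the maximum principle. The latter only needs mean values over
   circles, and these come from Goursat's theorem for rectangles applied in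
   logarithmic coordinates. *)

Require Import Defs.
From HB Require Import structures.
From mathcomp Require Import all_boot all_order all_algebra.
From mathcomp Require Import complex.
From mathcomp Require Import all_classical all_reals all_analysis.
From mathcomp Require Import measurable_realfun ring lra.
Import Order.TTheory GRing.Theory Num.Theory.
Import numFieldNormedType.Exports.
Set Implicit Arguments.
Unset Strict Implicit.
Unset Printing Implicit Defensive.
Local Open Scope classical_set_scope.
Local Open Scope ring_scope.
Local Open Scope complex_scope.

(** * Complex modulus and holomorphy *)

(** The density in EF3 may depend on [z] but not on [s], whereas the hypothesis concerns one orbit
    started at time 0. The composition law makes that orbit a probe for every [s]: the increment is
    known at the moving point a = W_(0,s)(T z0), and must be carried to T z with a constant free of
    [s]. Harnack's constant is (|a| + |T z|)^2 / (Re a Re T z). Julia's inequality keeps Re a >= Re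
    T z0, and the numerator is at most (A + V)^2 with A = |T z| + |T z0|; so the bound (A + V t)^2
    (V u - V t) lies below an increment of (A + V)^3, whence the cubic. The path is pushed forward
    by T, which is Lipschitz only away from the boundary; compactness of [0, b] provides the
    distance. The result is pulled back by S, which is Lipschitz on Re >= Re T z, where Julia's
    inequality keeps every W_(s,t)(T z). The Schwarz-Pick quotient is only shown to be continuous at
    its base point, so the maximum principle is stated with punctured discs of holomorphy. *)

Section Modulus.
Variable R : realType.
Implicit Types z w : R[i].

Lemma normc_cmod z : `|z| = (cmod z)%:C.
Proof. by rewrite /cmod normc_def. Qed.

Lemma cmodE z : cmod z = Num.sqrt (complex.Re z ^+ 2 + complex.Im z ^+ 2).
Proof. by rewrite /cmod normc_def. Qed.

Lemma sqr_cmod z : cmod z ^+ 2 = complex.Re z ^+ 2 + complex.Im z ^+ 2.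
Proof. by rewrite cmodE sqr_sqrtr// addr_ge0// sqr_ge0. Qed.

Lemma cmod_ge0 z : 0 <= cmod z.
Proof. by rewrite cmodE sqrtr_ge0. Qed.

Lemma cmodD z w : cmod (z + w) <= cmod z + cmod w.
Proof. by rewrite -lecR rmorphD/= -!normc_cmod ler_normD. Qed.

Lemma cmodM z w : cmod (z * w) = cmod z * cmod w.
Proof. by apply: complexI; rewrite rmorphM/= -!normc_cmod normrM. Qed.

Lemma cmodN z : cmod (- z) = cmod z.
Proof. by apply: complexI; rewrite -!normc_cmod normrN. Qed.

Lemma cmodBC z w : cmod (z - w) = cmod (w - z).
Proof. by rewrite -opprB cmodN. Qed.

Lemma cmodV z : cmod z^-1 = (cmod z)^-1.
Proof. by apply: complexI; rewrite fmorphV/= -!normc_cmod normfV. Qed.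

Lemma cmod0 : cmod (0 : R[i]) = 0.
Proof. by apply: complexI; rewrite -!normc_cmod normr0. Qed.

Lemma cmod1 : cmod (1 : R[i]) = 1.
Proof. by apply: complexI; rewrite -!normc_cmod normr1. Qed.

Lemma cmod_eq0 z : (cmod z == 0) = (z == 0).
Proof. by rewrite -(inj_eq (@complexI R)) -normc_cmod normr_eq0. Qed.

Lemma cmod_gt0 z : (0 < cmod z) = (z != 0).
Proof. by rewrite lt_def cmod_ge0 andbT cmod_eq0. Qed.

Lemma cmod_conj z : cmod (conjc z) = cmod z.
Proof. by apply: complexI; rewrite -!normc_cmod normcJ. Qed.

Lemma cmodR (x : R) : cmod x%:C = `|x|.
Proof. by rewrite cmodE /= expr0n addr0 sqrtr_sqr. Qed.

Lemma ler_Re_cmod z : `|complex.Re z| <= cmod z.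
Proof. by rewrite cmodE -sqrtr_sqr ler_wsqrtr// lerDl sqr_ge0. Qed.

Lemma ler_Im_cmod z : `|complex.Im z| <= cmod z.
Proof. by rewrite cmodE -sqrtr_sqr ler_wsqrtr// lerDr sqr_ge0. Qed.

Lemma cmod_le_ReIm z : cmod z <= `|complex.Re z| + `|complex.Im z|.
Proof.
rewrite -(@ler_pXn2r _ 2)// ?nnegrE ?cmod_ge0 ?addr_ge0//.
rewrite sqr_cmod sqrrD !real_normK ?num_real// lerD2r lerDl.
by rewrite mulrn_wge0// mulr_ge0.
Qed.

Lemma cReD z w : complex.Re (z + w) = complex.Re z + complex.Re w.
Proof. by case: z w => ? ? []. Qed.
Lemma cImD z w : complex.Im (z + w) = complex.Im z + complex.Im w.
Proof. by case: z w => ? ? []. Qed.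
Lemma cReN z : complex.Re (- z) = - complex.Re z. Proof. by case: z. Qed.
Lemma cImN z : complex.Im (- z) = - complex.Im z. Proof. by case: z. Qed.
Lemma cReM z w : complex.Re (z * w) =
  complex.Re z * complex.Re w - complex.Im z * complex.Im w.
Proof. by case: z w => ? ? []. Qed.
Lemma cImM z w : complex.Im (z * w) =
  complex.Re z * complex.Im w + complex.Im z * complex.Re w.
Proof. by case: z w => ? ? []. Qed.
Lemma cReJ z : complex.Re (conjc z) = complex.Re z. Proof. by case: z. Qed.
Lemma cImJ z : complex.Im (conjc z) = - complex.Im z. Proof. by case: z. Qed.

Lemma cmodB_ge z w : cmod z - cmod w <= cmod (z - w).
Proof. by rewrite lerBlDr -{1}(subrK w z) cmodD. Qed.

Lemma cReV z : complex.Re z^-1 = complex.Re z / cmod z ^+ 2.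
Proof. by rewrite sqr_cmod; case: z. Qed.

Lemma sqr_cmodDJ z w : cmod (z + conjc w) ^+ 2 =
  cmod (z - w) ^+ 2 + 4 * (complex.Re z * complex.Re w).
Proof. by rewrite !sqr_cmod; case: z w => a b [c d] /=; ring. Qed.

Lemma nbhs_cmodP z (A : set R[i]) :
  nbhs (z : R[i]^o) A <->
  exists2 d : R, 0 < d & forall y, cmod (y - z) < d -> A y.
Proof.
split.
  (* Radii of balls in [R[i]^o] are complex numbers; positivity forces the imaginary part [d'] to
     vanish. *)
  move=> /nbhs_ballP[[d d'] /= /andP[/eqP -> d0]] dA.
  exists d => // y yd; apply: dA; rewrite -ball_normE /=.
  by rewrite distrC normc_cmod ltcR.
move=> [d d0 dA]; apply/nbhs_ballP; exists d%:C => /=; first by rewrite ltcR.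
move=> y; rewrite -ball_normE /= distrC normc_cmod ltcR; exact: dA.
Qed.

End Modulus.


Section EpsilonDelta.
Variable K : numFieldType.

(** Multiplying the difference quotient by [y - x] makes the estimate hold at [y = x] as well, so
    the punctured filter disappears. The field is general because the bound serves complex
    derivatives as well as those of exp, cos and sin. *)
Lemma derivable_expansion (f : K^o -> K^o) (x : K^o) : derivable f x 1 ->
  forall e : K, 0 < e ->
    \forall y \near x, `|f y - f x - 'D_1 f x * (y - x)| <= e * `|y - x|.
Proof.
move=> df e e0.
have /cvgrPdist_le /(_ _ e0) : h^-1 *: ((f \o shift x) (h *: 1) - f x) @[h --> 0^'] --> 'D_1 f x by exact: df.
rewrite /dnbhs withinE => -[A nA HA].
have : \forall t \near (0 : K^o), A t by [].
rewrite (near_shift x) => nAx; near=> y.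
have [->|yx] := eqVneq y x; first by rewrite !subrr mulr0 subrr normr0 mulr0.
have yx0 : y - x != 0 by rewrite subr_eq0.
have /= Ay : A (y + (0 - x)) by near: y; exact: nAx.
rewrite sub0r in Ay.
have : (A `&` [set t | t != 0]) (y - x) by [].
rewrite -[X in X (y - x)]HA => -[/= + _].
rewrite [_%:A]mulr1 subrK /GRing.scale /= => H.
rewrite -[f y - f x](mulVKf yx0) mulrC -mulrBl normrM ler_wpM2r//.
by rewrite distrC.
Unshelve. all: by end_near. Qed.
End EpsilonDelta.

Lemma derivable_epsdelta (R : realType) (f : R[i] -> R[i]) (z : R[i]) :
  derivable (f : R[i]^o -> R[i]^o) z 1 ->
  exists l : R[i], forall e : R, 0 < e -> exists2 d : R, 0 < d &
    forall y, cmod (y - z) < d ->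
      cmod (f y - f z - l * (y - z)) <= e * cmod (y - z).
Proof.
move=> /derivable_expansion H; exists ('D_1 (f : R[i]^o -> R[i]^o) z) => e e0.
have /H/nbhs_cmodP[d d0 dH] : 0 < e%:C by rewrite ltcR.
by exists d => // y /dH; rewrite !normc_cmod -rmorphM/= lecR.
Qed.

Lemma continuous_cmodP (R : realType) (f : R[i] -> R[i]) (z : R[i]) :
  {for z, continuous (f : R[i]^o -> R[i]^o)} <->
  forall e : R, 0 < e -> exists2 d : R, 0 < d &
    forall y, cmod (y - z) < d -> cmod (f y - f z) < e.
Proof.
split=> [fz e e0|H].
  have : nbhs (f z : R[i]^o) [set y | cmod (y - f z) < e].
    by apply/nbhs_cmodP; exists e.
  by move=> /fz/nbhs_cmodP[d d0 dH]; exists d.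
move=> A /nbhs_cmodP[e /H[d d0 dH] eA]; apply/nbhs_cmodP.
by exists d => // y /dH/eA.
Qed.

Lemma derivable_cmod_continuous (R : realType) (f : R[i] -> R[i]) (z : R[i]) :
  derivable (f : R[i]^o -> R[i]^o) z 1 ->
  {for z, continuous (f : R[i]^o -> R[i]^o)}.
Proof. by move=> /derivable1_diffP/differentiable_continuous. Qed.

Lemma derivable1_epsdelta (R : realType) (f : R -> R) (x l : R) :
  is_derive x 1 f l -> forall e : R, 0 < e -> exists2 d : R, 0 < d &
    forall h, `|h| < d -> `|f (x + h) - f x - l * h| <= e * `|h|.
Proof.
move=> [fx <-] e /(derivable_expansion fx)/nbhs_ballP[d /= d0 dH].
exists d => // h hd; have := dH (x + h).
by rewrite -ball_normE /= [x + h]addrC addrK opprD addrA addrAC subrr sub0r normrN; exact.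
Qed.

Section Holomorphic.
Variable R : realType.
Local Notation C := (R[i]^o).
Implicit Types (f g : R[i] -> R[i]) (z c : R[i]).

Definition holomorphic_at f z := derivable (f : C -> C) z 1.
Definition ccontinuous_at f z := {for z, continuous (f : C -> C)}.

Lemma holomorphic_at_cst c z : holomorphic_at (fun=> c) z.
Proof. exact: (@derivable_cst _ C C c z 1). Qed.

Lemma holomorphic_at_id z : holomorphic_at id z.
Proof. exact: (@derivable_id _ C z 1). Qed.

Lemma holomorphic_atD f g z : holomorphic_at f z -> holomorphic_at g z ->
  holomorphic_at (fun x => f x + g x) z.
Proof. exact: (@derivableD _ C C f g z 1). Qed.

Lemma holomorphic_atB f g z : holomorphic_at f z -> holomorphic_at g z ->
  holomorphic_at (fun x => f x - g x) z.
Proof. exact: (@derivableB _ C C f g z 1). Qed.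

Lemma holomorphic_atM f g z : holomorphic_at f z -> holomorphic_at g z ->
  holomorphic_at (fun x => f x * g x) z.
Proof. exact: (@derivableM _ C f g z 1). Qed.

Lemma holomorphic_atV f z : f z != 0 -> holomorphic_at f z ->
  holomorphic_at (fun x => (f x)^-1) z.
Proof. exact: (@derivableV _ C f z 1). Qed.

Lemma holomorphic_at_comp f g z : holomorphic_at g (f z) -> holomorphic_at f z ->
  holomorphic_at (g \o f) z.
Proof.
move=> /(@derivable1_diffP _ C g) dg /(@derivable1_diffP _ C f) df.
apply/(@derivable1_diffP _ C (g \o f)).
exact: (@differentiable_comp _ C C C f g z df dg).
Qed.

Lemma holomorphic_at_near f g z (d : R) : 0 < d ->
  (forall y, cmod (y - z) < d -> f y = g y) ->
  holomorphic_at f z -> holomorphic_at g z.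
Proof.
move=> d0 fg.
have fg' : nbhs (z : C) (fun y => f y = g y) by apply/nbhs_cmodP; exists d.
exact: (@near_eq_derivable _ C C f g z 1 fg').
Qed.

Lemma holomorphic_at_continuous f z : holomorphic_at f z -> ccontinuous_at f z.
Proof. exact: derivable_cmod_continuous. Qed.

Lemma holomorphic_at_derivable f z :
  holomorphic_at f z <-> derivable (f : C -> C) z 1.
Proof. by []. Qed.

Lemma holomorphic_at_expansion f z : holomorphic_at f z ->
  exists l : R[i], forall e : R, 0 < e -> exists2 d : R, 0 < d &
    forall y, cmod (y - z) < d ->
      cmod (f y - f z - l * (y - z)) <= e * cmod (y - z).
Proof. exact: derivable_epsdelta. Qed.

Lemma ccontinuous_at_cst c z : ccontinuous_at (fun=> c) z.
Proof. exact: cst_continuous. Qed.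

Lemma ccontinuous_atM f g z : ccontinuous_at f z -> ccontinuous_at g z ->
  ccontinuous_at (fun x => f x * g x) z.
Proof. exact: (@continuousM _ C f g z). Qed.

Lemma ccontinuous_atD f g z : ccontinuous_at f z -> ccontinuous_at g z ->
  ccontinuous_at (fun x => f x + g x) z.
Proof. exact: (@continuousD _ C C f g z). Qed.

End Holomorphic.

(* Keeps unification from unfolding derivatives. *)
#[global] Opaque holomorphic_at.

(** * Goursat's theorem for rectangles *)

Section Bisection.
Variable R : realType.

(** If [G] failed on the whole rectangle, it would fail on a quarter, then on a quarter of that one;
    the nested rectangles shrink to a point, where the local hypothesis is contradicted. *)
Lemma rectangle_bisection (G : R -> R -> R -> R -> Prop) (a b c d : R) :
  a <= b -> c <= d ->
  (forall x w y h, 0 <= w -> 0 <= h ->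
     G x (x + w) y (y + h) -> G x (x + w) (y + h) (y + h + h) ->
     G (x + w) (x + w + w) y (y + h) ->
     G (x + w) (x + w + w) (y + h) (y + h + h) ->
     G x (x + w + w) y (y + h + h)) ->
  (forall x y, a <= x <= b -> c <= y <= d -> exists2 e, 0 < e &
     forall n x' y', x' <= x <= x' + (b - a) / 2 ^+ n ->
       y' <= y <= y' + (d - c) / 2 ^+ n ->
       (b - a) / 2 ^+ n < e -> (d - c) / 2 ^+ n < e ->
       a <= x' -> x' + (b - a) / 2 ^+ n <= b ->
       c <= y' -> y' + (d - c) / 2 ^+ n <= d ->
       G x' (x' + (b - a) / 2 ^+ n) y' (y' + (d - c) / 2 ^+ n)) ->
  G a b c d.
Proof.
move=> ab cd Gsplit Gloc; apply: contrapT => nG.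
pose w n : R := (b - a) / 2 ^+ n; pose h n : R := (d - c) / 2 ^+ n.
have wS n : w n = w n.+1 + w n.+1.
  by rewrite /w exprSr; field; rewrite expf_neq0.
have hS n : h n = h n.+1 + h n.+1.
  by rewrite /h exprSr; field; rewrite expf_neq0.
have w0 n : 0 <= w n by rewrite divr_ge0 ?subr_ge0// exprn_ge0.
have h0 n : 0 <= h n by rewrite divr_ge0 ?subr_ge0// exprn_ge0.
have wE n : w n = (b - a) / 2 ^+ n by [].
have hE n : h n = (d - c) / 2 ^+ n by [].
clearbody w h.
pose B n (p : R * R) := ~ G p.1 (p.1 + w n) p.2 (p.2 + h n).
have step n (p : R * R) : B n p -> { q : R * R | [/\ B n.+1 q,
    p.1 <= q.1, q.1 + w n.+1 <= p.1 + w n,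
    p.2 <= q.2 & q.2 + h n.+1 <= p.2 + h n] }.
  move=> Bp; apply: cid; apply: contrapT => H; apply: Bp; rewrite wS hS !addrA.
  have wp := w0 n.+1; have hp := h0 n.+1.
  apply: Gsplit => //; apply: contrapT => nG'; apply: H.
  - by exists p; split; rewrite // ?(wS n) ?(hS n); lra.
  - exists (p.1, p.2 + h n.+1); split; rewrite /= ?(wS n) ?(hS n) //; clear -wp hp; lra.
  - exists (p.1 + w n.+1, p.2); split; rewrite /= ?(wS n) ?(hS n) //; clear -wp hp; lra.
  - exists (p.1 + w n.+1, p.2 + h n.+1); split; rewrite /= ?(wS n) ?(hS n) //; clear -wp hp; lra.
have B0 : B 0%N (a, c) by rewrite /B /= wE hE expr0 !divr1 !subrKC.
pose fix sq n : {p | B n p} := match n with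
  | 0 => exist _ (a, c) B0
  | n'.+1 => let: exist p Bp := sq n' in
             let: exist q Hq := step n' p Bp in
             exist _ q (let: And5 H _ _ _ _ := Hq in H)
  end.
pose p n := sval (sq n).
have pB n : B n (p n) by rewrite /p; case: (sq n).
have pS n : [/\ (p n).1 <= (p n.+1).1, (p n.+1).1 + w n.+1 <= (p n).1 + w n,
    (p n).2 <= (p n.+1).2 & (p n.+1).2 + h n.+1 <= (p n).2 + h n].
  by rewrite /p /=; case: (sq n) => q Bq; case: (step n q Bq) => q' [].
have mono (u : nat -> R) : (forall n, u n <= u n.+1) -> {homo u : m n / (m <= n)%N >-> m <= n}.
  by move=> uS; apply: homo_leq => //; exact: le_trans.
have limit (u v : nat -> R) : (forall n, u n <= u n.+1) ->
    (forall n, 0 <= v n) -> (forall n, u n.+1 + v n.+1 <= u n + v n) ->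
    exists x, forall n, u n <= x <= u n + v n.
  move=> uS v0 uvS.
  have um := mono _ uS.
  have uvm m n : (m <= n)%N -> u n + v n <= u m + v m.
    move=> mn; rewrite -lerN2; apply: (mono (fun n => - (u n + v n))) => // k.
    by rewrite lerN2.
  have ub m n : u m <= u n + v n.
    have [mn|/ltnW nm] := leqP m n.
      by rewrite (le_trans (um _ _ mn))// lerDl.
    by rewrite (le_trans _ (uvm _ _ nm))// lerDl.
  have hs : has_sup (range u).
    split; first by exists (u 0%N); exists 0%N.
    by exists (u 0%N + v 0%N) => _ [m _ <-].
  exists (sup (range u)) => n; apply/andP; split.
    by apply: sup_upper_bound => //; exists n.
  by apply: sup_le_ub; [exact: hs.1|move=> _ [m _ <-]].
have [x xP] : exists x, forall n, (p n).1 <= x <= (p n).1 + w n.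
  by apply: limit => // n; have [] := pS n.
have [y yP] : exists y, forall n, (p n).2 <= y <= (p n).2 + h n.
  by apply: limit => // n; have [] := pS n.
have pin n : [/\ a <= (p n).1, (p n).1 + w n <= b, c <= (p n).2 & (p n).2 + h n <= d].
  elim: n => [|n [? ? ? ?]]; last by have [? ? ? ?] := pS n; split; lra.
  by rewrite /= wE hE expr0 !divr1; split; rewrite //= subrKC.
have xab : a <= x <= b.
  by have [? ? ? ?] := pin 0%N; have /andP[? ?] := xP 0%N; apply/andP; split; lra.
have ycd : c <= y <= d.
  by have [? ? ? ?] := pin 0%N; have /andP[? ?] := yP 0%N; apply/andP; split; lra.
have [e e0 eG] := Gloc x y xab ycd.
have small (l : R) : 0 <= l -> exists m, forall n, (m <= n)%N -> l / 2 ^+ n < e.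
  move=> l0; exists (Num.bound (l / e)) => n mn.
  rewrite ltr_pdivrMr ?exprn_gt0// mulrC -ltr_pdivrMr//.
  have := archi_boundP (divr_ge0 l0 (ltW e0)); move=> /lt_le_trans; apply.
  by rewrite -natrX ler_nat (leq_trans mn)// ltnW// ltn_expl.
have [m1 M1] := small (b - a) ltac:(by rewrite subr_ge0).
have [m2 M2] := small (d - c) ltac:(by rewrite subr_ge0).
have [? ? ? ?] := pin (maxn m1 m2).
apply: (pB (maxn m1 m2)); move: (xP (maxn m1 m2)) (yP (maxn m1 m2)).
rewrite wE hE => ? ?; apply: eG => //; rewrite -?wE -?hE //.
- by rewrite wE; apply: M1; rewrite leq_maxl.
- by rewrite hE; apply: M2; rewrite leq_maxr.
Qed.

End Bisection.

Section Goursat.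
Variable R : realType.
Local Notation mu := (@lebesgue_measure R).
Implicit Types (f g : R -> R) (a b c d : R).

Lemma continuous_itv_integrable f a b :
  {in `[a, b], continuous f} -> mu.-integrable `[a, b] (EFin \o f).
Proof.
move=> cf; apply: continuous_compact_integrable; first exact: segment_compact.
by apply: continuous_in_subspaceT => x /set_mem/cf.
Qed.

Lemma Rintegral_itv_split f a c b : a <= c -> c <= b ->
  {in `[a, b], continuous f} ->
  Rintegral mu `[a, b] f = Rintegral mu `[a, c] f + Rintegral mu `[c, b] f.
Proof.
move=> ac cb cf.
have itf := continuous_itv_integrable cf.
have /= := @Rintegral_itvB R f (BLeft a) (BRight b) c itf.
rewrite !bnd_simp => /(_ ac cb) /eqP.
rewrite subr_eq addrC => /eqP ->; congr (_ + _).
rewrite Rintegral_itv_obnd_cbnd//.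
by apply: integrableS itf => //; apply: subset_itv; rewrite bnd_simp.
Qed.

Lemma Rintegral_itv_cst a b (k : R) : a <= b ->
  Rintegral mu `[a, b] (fun=> k) = k * (b - a).
Proof.
move=> ab; rewrite /Rintegral integral_cst//= lebesgue_measure_itv /= lte_fin.
by case: ltgtP ab => //= -> _; rewrite mulr0 subrr mulr0.
Qed.

Lemma Rintegral_itv_approx f a b (k e : R) : a <= b ->
  {in `[a, b], continuous f} -> (forall x, x \in `[a, b] -> `|f x - k| <= e) ->
  `|Rintegral mu `[a, b] f - k * (b - a)| <= e * (b - a).
Proof.
move=> ab cf fk.
have ck (r : R) : {in `[a, b], continuous (fun=> r)}.
  by move=> x _; exact: cst_continuous.
have cfk : {in `[a, b], continuous (fun x => f x - k)}.
  by move=> x xab; apply: continuousB; [exact: cf|exact: cst_continuous].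
rewrite -[k * _]Rintegral_itv_cst// -RintegralB//; last 2 first.
  exact: continuous_itv_integrable.
  exact: (continuous_itv_integrable (ck k)).
apply: le_trans (le_normr_Rintegral _ _) _ => //.
  exact: (continuous_itv_integrable cfk).
rewrite -Rintegral_itv_cst//; apply: le_Rintegral => //.
- apply: continuous_itv_integrable => x xab.
  by apply: (continuous_comp (cfk x xab)); exact: norm_continuous.
- exact: (continuous_itv_integrable (ck e)).
Qed.

Lemma Rintegral_itvD f g a b :
  {in `[a, b], continuous f} -> {in `[a, b], continuous g} ->
  Rintegral mu `[a, b] (fun x => f x + g x) =
  Rintegral mu `[a, b] f + Rintegral mu `[a, b] g.
Proof. by move=> cf cg; rewrite RintegralD//; exact: continuous_itv_integrable. Qed.

(* The integral of [P dx + Q dy] along the boundary, grouped so that each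
   integrand is a difference: only the mixed derivatives then matter. *)
Definition circulation (P Q : R -> R -> R) a b c d :=
  Rintegral mu `[a, b] (fun x => P x c - P x d) +
  Rintegral mu `[c, d] (fun y => Q b y - Q a y).

(* [P dx + Q dy] is closed to first order at [(x, y)]: the partial derivatives
   of [P] in [y] and of [Q] in [x] have the common value [k]. *)
Definition closed_at (P Q : R -> R -> R) (x y : R) :=
  exists p q k : R, forall e : R, 0 < e -> exists2 r : R, 0 < r & forall x' y' : R,
    `|x' - x| < r -> `|y' - y| < r ->
    `|P x' y' - P x y - (p * (x' - x) + k * (y' - y))| <=
      e * (`|x' - x| + `|y' - y|) /\
    `|Q x' y' - Q x y - (k * (x' - x) + q * (y' - y))| <=
      e * (`|x' - x| + `|y' - y|).

(** Exchanging the coordinates turns continuity of [P] in its first variable into continuity of [Q]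
    in its second. *)
Lemma closed_at_sym P Q x y : closed_at P Q x y ->
  closed_at (fun y x => Q x y) (fun y x => P x y) y x.
Proof.
move=> [p [q [k H]]]; exists q, p, k => e /H[r r0 rH]; exists r => // y' x' ? ?.
rewrite [`|y' - y| + _]addrC [q * _ + _]addrC [k * (y' - y) + _]addrC.
by have [] := rH x' y'.
Qed.

Lemma continuous_epsdelta f x : (forall e : R, 0 < e -> exists2 d : R, 0 < d &
    forall y, `|y - x| < d -> `|f y - f x| < e) -> {for x, continuous f}.
Proof.
move=> H; apply/cvgrPdist_lt => e /H[d d0 dH]; apply/nbhs_ballP; exists d => //.
by move=> y; rewrite /= distrC => /dH; rewrite distrC.
Qed.

Lemma closed_at_continuous P Q x y : closed_at P Q x y ->
  {for x, continuous (P ^~ y)}.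
Proof.
move=> [p [q [k H]]]; apply: continuous_epsdelta => e e0.
have [r r0 rH] := H 1 ltr01.
have p0 : 0 < `|p| + 1 by rewrite ltr_wpDl.
exists (Num.min r (e / (`|p| + 1))).
  by rewrite lt_min r0 divr_gt0.
move=> z; rewrite lt_min => /andP[zr ze].
have [|+ _] := rH z y zr; first by rewrite subrr normr0.
rewrite subrr normr0 mulr0 !addr0 mul1r => Pz.
rewrite -(subrK (p * (z - x)) (P z y - P x y)) (le_lt_trans (ler_normD _ _))//.
rewrite ltr_pdivlMr// mulrC mulrDl mul1r in ze.
by rewrite (le_lt_trans _ ze)// normrM addrC lerD2l.
Qed.

Section Rectangle.
Variables (P Q : R -> R -> R) (X : R).
Hypothesis PQ : forall x y, x < X -> closed_at P Q x y.

Let cP y a b : b < X -> {in `[a, b], continuous (P ^~ y)}.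
Proof.
move=> bX x; rewrite in_itv/= => /andP[_ xb].
by apply: closed_at_continuous; apply: PQ; exact: le_lt_trans bX.
Qed.

Let cQ x : x < X -> forall c d, {in `[c, d], continuous (Q x)}.
Proof.
move=> xX c d y _.
exact: (closed_at_continuous (closed_at_sym (PQ y xX))).
Qed.

Let circ_row (x y w h k : R) : 0 <= w -> x + w < X ->
  Rintegral mu `[x, x + w] (fun t => P t y - P t k) =
  Rintegral mu `[x, x + w] (fun t => P t y - P t h) +
  Rintegral mu `[x, x + w] (fun t => P t h - P t k).
Proof.
move=> w0 xX; rewrite -Rintegral_itvD.
- by apply: eq_Rintegral => t _; rewrite addrA subrK.
- by move=> t tx; apply: continuousB; exact: cP tx.
- by move=> t tx; apply: continuousB; exact: cP tx.
Qed.

Let circ_col (y h a b c : R) : a < X -> b < X -> c < X ->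
  Rintegral mu `[y, y + h] (fun t => Q c t - Q a t) =
  Rintegral mu `[y, y + h] (fun t => Q b t - Q a t) +
  Rintegral mu `[y, y + h] (fun t => Q c t - Q b t).
Proof.
move=> aX bX cX; have cQB u v : u < X -> v < X ->
    {in `[y, y + h], continuous (fun t => Q v t - Q u t)}.
  by move=> uX vX t ty; apply: continuousB; exact: cQ ty.
rewrite -(Rintegral_itvD (cQB a b aX bX) (cQB b c bX cX)).
by apply: eq_Rintegral => t _; rewrite [RHS]addrC addrA subrK.
Qed.

Lemma circulation_quarters (x w y h : R) : 0 <= w -> 0 <= h -> x + w + w < X ->
  circulation P Q x (x + w + w) y (y + h + h) =
  circulation P Q x (x + w) y (y + h) +
  circulation P Q x (x + w) (y + h) (y + h + h) +
  circulation P Q (x + w) (x + w + w) y (y + h) +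
  circulation P Q (x + w) (x + w + w) (y + h) (y + h + h).
Proof.
move=> w0 h0 xX; have xwX : x + w < X by rewrite (le_lt_trans _ xX)// lerDl.
have x0X : x < X by rewrite (le_lt_trans _ xwX)// lerDl.
rewrite /circulation (@Rintegral_itv_split _ x (x + w)) ?lerDl//; last first.
  by move=> t tx; apply: continuousB; exact: cP tx.
rewrite (@Rintegral_itv_split _ y (y + h)) ?lerDl//; last first.
  by move=> t ty; apply: continuousB; exact: cQ ty.
rewrite (circ_row y (y + h) (y + h + h) w0 xwX) (circ_row y (y + h) (y + h + h) w0 xX).
rewrite (circ_col y h x0X xwX xX) (circ_col (y + h) h x0X xwX xX).
by ring.
Qed.

(** To first order the two integrands are the constants [- k * h] and [k * w], so their integrals
    [- k h w] and [k w h] cancel. Each integrand is a difference of two values known up to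
    [e / 2 * (w + h)]; integration over the lengths [w] and [h] leaves [e * (w + h) ^+ 2]. *)
Lemma circulation_local (x y e : R) : x < X -> 0 < e -> exists2 r : R, 0 < r &
  forall x' y' w h : R, x' <= x <= x' + w -> y' <= y <= y' + h -> x' + w < X ->
    w < r -> h < r ->
    `|circulation P Q x' (x' + w) y' (y' + h)| <= e * (w + h) ^+ 2.
Proof.
move=> xX e0; have [p [q [k H]]] := PQ y xX.
have e20 : 0 < e / 2 by rewrite divr_gt0.
have [r r0 rH] := H _ e20; exists r => // x' y' w h /andP[x'x xx'] /andP[y'y yy'] xwX wr hr.
have near_x t : x' <= t -> t <= x' + w -> `|t - x| <= w.
  by move=> ? ?; rewrite ler_norml; apply/andP; split; lra.
have near_y t : y' <= t -> t <= y' + h -> `|t - y| <= h.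
  by move=> ? ?; rewrite ler_norml; apply/andP; split; lra.
have w0 : 0 <= w by lra.
have h0 : 0 <= h by lra.
have HP t u : x' <= t -> t <= x' + w -> y' <= u -> u <= y' + h ->
    `|P t u - P x y - (p * (t - x) + k * (u - y))| <= e / 2 * (w + h) /\
    `|Q t u - Q x y - (k * (t - x) + q * (u - y))| <= e / 2 * (w + h).
  move=> xt tx yu uy; have tw := near_x _ xt tx; have uh := near_y _ yu uy.
  have [] := rH t u (le_lt_trans tw wr) (le_lt_trans uh hr).
  have s : `|t - x| + `|u - y| <= w + h by rewrite lerD.
  by move=> H1 H2; split; [apply: le_trans H1 _|apply: le_trans H2 _];
    rewrite ler_wpM2l// ltW.
have IP : `|Rintegral mu `[x', x' + w] (fun t => P t y' - P t (y' + h))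
          - - (k * h) * (x' + w - x')| <= e * (w + h) * (x' + w - x').
  apply: Rintegral_itv_approx; first by lra.
    by move=> t tx; apply: continuousB; exact: cP tx.
  move=> t; rewrite in_itv/= => /andP[xt tx].
  have [] := HP t y' xt tx ltac:(lra) ltac:(lra).
  have [] := HP t (y' + h) xt tx ltac:(lra) ltac:(lra).
  rewrite !ler_norml => /andP[? ?] _ /andP[? ?] _.
  by apply/andP; split; lra.
have IQ : `|Rintegral mu `[y', y' + h] (fun t => Q (x' + w) t - Q x' t)
          - (k * w) * (y' + h - y')| <= e * (w + h) * (y' + h - y').
  apply: Rintegral_itv_approx; first by lra.
    by move=> t tx; apply: continuousB; apply: cQ tx => //; lra.
  move=> t; rewrite in_itv/= => /andP[xt tx].
  have [] := HP x' t ltac:(lra) ltac:(lra) xt tx.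
  have [] := HP (x' + w) t ltac:(lra) ltac:(lra) xt tx.
  rewrite !ler_norml => _ /andP[? ?] _ /andP[? ?].
  by apply/andP; split; lra.
rewrite /circulation.
move: (Rintegral _ _ _) (Rintegral _ _ _) IP IQ => A B.
rewrite !ler_norml => /andP[? ?] /andP[? ?].
by apply/andP; split; lra.
Qed.

(** Closedness is assumed on a half-plane because in logarithmic coordinates the first variable is
    the logarithm of a radius and the second a free angle. *)
Lemma circulation_eq0 a b c d : a <= b -> c <= d -> b < X ->
  circulation P Q a b c d = 0.
Proof.
move=> ab cd bX; apply/eqP; rewrite -normr_le0; apply/ler_addgt0Pr => e0 e00.
rewrite add0r; set s := (b - a + (d - c)) ^+ 2.
have s1 : 0 < s + 1 by rewrite ltr_wpDl ?sqr_ge0.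
suff H e : 0 < e -> b < X -> `|circulation P Q a b c d| <= e * s.
  apply: le_trans (H (e0 / (s + 1)) _ bX) _; first by rewrite divr_gt0.
  by rewrite mulrAC ler_pdivrMr// ler_wpM2l ?(ltW e00)// lerDl.
move=> e0'; rewrite /s {s s1}; move: e0' => {e0 e00} e0.
(* The bound is quadratic in the half-perimeter, so the bounds of the four quarters add up exactly
   to that of the whole. *)
apply: (@rectangle_bisection _
  (fun a b c d => b < X -> `|circulation P Q a b c d| <= e * (b - a + (d - c)) ^+ 2)) => //.
  move=> x w y h w0 h0 H1 H2 H3 H4 xX.
  have xwX : x + w < X by rewrite (le_lt_trans _ xX)// lerDl.
  rewrite circulation_quarters//.
  have := H1 xwX; have := H2 xwX; have := H3 xX; have := H4 xX.
  rewrite !ler_norml => /andP[? ?] /andP[? ?] /andP[? ?] /andP[? ?].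
  by apply/andP; split; lra.
move=> x y /andP[ax xb] _; have xX : x < X by exact: le_lt_trans bX.
have [r r0 rH] := circulation_local y xX e0.
exists r => // n x' y' ? ? ? ? _ _ _ _ ?; have cancel u v : u + v - u = v :> R by rewrite addrC addKr.
by rewrite !cancel; apply: rH.
Qed.

End Rectangle.
End Goursat.

(** * The maximum principle *)

Section Polar.
Variable R : realType.
Implicit Types (s t : R) (z p : R[i]).

Definition cexp s t : R[i] := expR s * cos t +i* (expR s * sin t).

Lemma cexpD s t s' t' : cexp (s + s') (t + t') = cexp s t * cexp s' t'.
Proof.
by rewrite /cexp expRD cosD sinD; apply/eqP; rewrite eq_complex /=; apply/andP; split; apply/eqP; ring.
Qed.

Lemma cmod_cexp s t : cmod (cexp s t) = expR s.
Proof.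
by rewrite cmodE /= !exprMn -mulrDr cos2Dsin2 mulr1 sqrtr_sqr ger0_norm// expR_ge0.
Qed.

Lemma cexp_2pi s : cexp s (pi *+ 2) = cexp s 0.
Proof. by rewrite /cexp -[pi *+ 2]add0r cosD2pi sinD2pi. Qed.

Lemma cexp_expansion0 (e : R) : 0 < e -> exists2 d : R, 0 < d &
  forall s t, `|s| < d -> `|t| < d ->
    cmod (cexp s t - 1 - (s +i* t)) <= e * (`|s| + `|t|).
Proof.
(* The errors add up to [e' |s| + 7 e' |t|], whence the 8; [e' <= 1] yields [|1 + s| <= 2] and
   [|sin t| <= 2 |t|]. *)
move=> e0; pose e' := Num.min (e / 8) 1.
have e'0 : 0 < e' by rewrite lt_min divr_gt0 ?ltr01.
have e'e : e' <= e / 8 by rewrite ge_min lexx.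
have e'1 : e' <= 1 by rewrite ge_min lexx orbT.
clearbody e'.
have [d1 d10 H1] := derivable1_epsdelta (is_derive_expR (0 : R)) e'0.
have [d2 d20 H2] := derivable1_epsdelta (is_derive_cos (0 : R)) e'0.
have [d3 d30 H3] := derivable1_epsdelta (is_derive_sin (0 : R)) e'0.
exists (Num.min (Num.min d1 d2) (Num.min d3 e')); first by rewrite !lt_min d10 d20 d30 e'0.
move=> s t; rewrite !lt_min => /andP[/andP[s1 s2] /andP[s3 s4]] /andP[/andP[t1 t2] /andP[t3 t4]].
have := H1 s s1; have := H2 t t2; have := H3 t t3.
rewrite !add0r expR0 cos0 sin0 oppr0 mul0r !mul1r !subr0 !addr0 => Hs Hc He.
apply: le_trans (cmod_le_ReIm _) _; rewrite /= subr0.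
have e1 : `|expR s - 1| <= 2 * e'.
  rewrite -(subrK s (expR s - 1)) (le_trans (ler_normD _ _))//.
  apply: le_trans (lerD He (lexx _)) _.
  have : e' * `|s| <= 1 * e' by rewrite ler_pM// ltW// (lt_le_trans s4).
  have := ltW s4; lra.
have E1 : expR s * cos t - 1 - s = (expR s - 1 - s) * cos t + (1 + s) * (cos t - 1).
  by ring.
have E2 : expR s * sin t - t = (expR s - 1) * sin t + (sin t - t) by ring.
have b1 : `|expR s * cos t - 1 - s| <= e' * `|s| + 2 * (e' * `|t|).
  rewrite E1 (le_trans (ler_normD _ _))// lerD// normrM.
    rewrite -[leRHS]mulr1 ler_pM//.
    by rewrite ler_norml cos_le1 cos_geN1.
  rewrite ler_pM// (le_trans (ler_normD _ _))// normr1 -[leRHS]/(1 + 1) lerD2l.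
  by rewrite ltW// (lt_le_trans s4).
have b2 : `|expR s * sin t - t| <= 4 * (e' * `|t|) + e' * `|t|.
  rewrite E2 (le_trans (ler_normD _ _))// lerD// normrM.
  rewrite [leRHS](_ : _ = 2 * e' * (2 * `|t|)); last by ring.
  rewrite ler_pM// -(subrK t (sin t)) (le_trans (ler_normD _ _))//.
  have : e' * `|t| <= 1 * `|t| by rewrite ler_wpM2r.
  lra.
have s0 := normr_ge0 s; have t0 := normr_ge0 t.
have es : e' * `|s| <= e / 8 * `|s| by rewrite ler_wpM2r.
have et : e' * `|t| <= e / 8 * `|t| by rewrite ler_wpM2r.
have es0 : 0 <= e * `|s| by rewrite mulr_ge0 ?(ltW e0).
have et0 : 0 <= e * `|t| by rewrite mulr_ge0 ?(ltW e0).
lra.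
Qed.

Lemma cexp_expansion s0 t0 (e : R) : 0 < e -> exists2 d : R, 0 < d &
  forall s t, `|s - s0| < d -> `|t - t0| < d ->
    cmod (cexp s t - cexp s0 t0 - cexp s0 t0 * ((s - s0) +i* (t - t0))) <=
    e * (`|s - s0| + `|t - t0|).
Proof.
move=> e0; have E0 : 0 < expR s0 by exact: expR_gt0.
have [|d d0 H] := @cexp_expansion0 (e / expR s0); first by rewrite divr_gt0.
exists d => // s t sd td.
rewrite -[s in cexp s](subrKC s0) -[t in cexp _ t](subrKC t0) cexpD.
rewrite -[X in _ - X - _]mulr1 -!mulrBr cmodM cmod_cexp -ler_pdivlMl//.
by rewrite mulrA [_^-1 * e]mulrC H.
Qed.

(** With [l] the derivative of [g], the differential of [g (p + cexp s t)] is [l E (ds + i dt)]. The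
    Cauchy-Riemann equation says that the derivative of the imaginary part in [t] and that of the
    real part in [s] are both [Re (l E)]. *)
Lemma holomorphic_polar_closed (g : R[i] -> R[i]) p s t :
  holomorphic_at g (p + cexp s t) ->
  closed_at (fun s t => complex.Im (g (p + cexp s t)))
            (fun s t => complex.Re (g (p + cexp s t))) s t.
Proof.
move=> /holomorphic_at_expansion[l gl]; set E := cexp s t.
exists (complex.Im (l * E)), (- complex.Im (l * E)), (complex.Re (l * E)) => e e0.
have cE := cmod_ge0 E; have cl := cmod_ge0 l.
have E1 : 0 < cmod E + 1 by lra.
have l1 : 0 < cmod l + 1 by lra.
(* The error of [g] is scaled by [cmod E + 1] and that of [cexp] by [cmod l]; each receives half of
   [e]. The cap 1 in [e2] bounds the increment of the argument by [(cmod E + 1) * n]. *)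
pose e1 := e / (2 * (cmod E + 1)).
have e10 : 0 < e1 by rewrite divr_gt0// mulr_gt0.
pose e2 := Num.min 1 (e / (2 * (cmod l + 1))).
have e20 : 0 < e2 by rewrite lt_min ltr01 divr_gt0// mulr_gt0.
have [d1 d10 H1] := gl _ e10; have [d2 d20 H2] := cexp_expansion s t e20.
exists (Num.min d2 (d1 / (2 * (cmod E + 1)))).
  by rewrite lt_min d20 divr_gt0// mulr_gt0.
move=> s' t'; rewrite !lt_min => /andP[s'2 s'1] /andP[t'2 t'1].
have := H2 _ _ s'2 t'2; set D := (s' - s) +i* (t' - t); set n := `|_| + `|_|.
rewrite -/E; set r := cexp s' t' - E - E * D => rn.
have n0 : 0 <= n by rewrite addr_ge0.
have Dn : cmod D <= n by exact: cmod_le_ReIm.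
have e2n : e2 * n <= n by rewrite ler_piMl// ge_min lexx.
have zE : p + cexp s' t' - (p + E) = E * D + r.
  by rewrite /r; ring.
have zn : cmod (p + cexp s' t' - (p + E)) <= (cmod E + 1) * n.
  rewrite zE (le_trans (cmodD _ _))// cmodM mulrDl mul1r lerD ?ler_wpM2l//.
  exact: le_trans rn _.
have nd : (cmod E + 1) * n < d1.
  rewrite mulrC -ltr_pdivlMr// [ltRHS](_ : _ = d1 / (2 * (cmod E + 1)) + d1 / (2 * (cmod E + 1))).
    by rewrite ltrD.
  by field; rewrite gt_eqF.
have K : cmod (g (p + cexp s' t') - g (p + E) - l * E * D) <= e * n.
  have -> : g (p + cexp s' t') - g (p + E) - l * E * D =
     (g (p + cexp s' t') - g (p + E) - l * (p + cexp s' t' - (p + E))) + l * r.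
    by rewrite zE mulrDr opprD !addrA subrK mulrA.
  rewrite (le_trans (cmodD _ _))// cmodM.
  have -> : e * n = e / 2 * n + e / 2 * n by field.
  rewrite lerD//.
    apply: le_trans (H1 _ (le_lt_trans zn nd)) _.
    rewrite (le_trans (ler_wpM2l (ltW e10) zn))// mulrA ler_wpM2r//.
    by rewrite /e1 le_eqVlt; apply/orP; left; apply/eqP; field; rewrite gt_eqF.
  rewrite (le_trans (ler_wpM2l cl rn))// mulrA ler_wpM2r//.
  have : cmod l * e2 <= (cmod l + 1) * (e / (2 * (cmod l + 1))).
    by rewrite ler_pM// ?(ltW e20)// ?lerDl// ge_min lexx orbT.
  move/le_trans; apply; rewrite le_eqVlt; apply/orP; left; apply/eqP; field.
  by rewrite gt_eqF.
split.
  apply: le_trans K; apply: le_trans (ler_Im_cmod _).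
  rewrite !cImD !cImN (cImM (l * E)) /= le_eqVlt; apply/orP; left; apply/eqP; congr `|_|; ring.
apply: le_trans K; apply: le_trans (ler_Re_cmod _).
rewrite !cReD !cReN (cReM (l * E)) /= le_eqVlt; apply/orP; left; apply/eqP; congr `|_|; ring.
Qed.

(* In the coordinates [z = p + exp (s + i t)] the form [Im g ds + Re g dt] is
   closed and periodic in [t], so circle means do not depend on the radius; the
   center itself may be exceptional. *)
Lemma center_le_of_circle_le (g : R[i] -> R[i]) p (r1 r2 c : R) :
  0 < r1 -> r1 < r2 ->
  (forall z, 0 < cmod (z - p) -> cmod (z - p) < r2 ->
    holomorphic_at g z) ->
  ccontinuous_at g p ->
  (forall z, cmod (z - p) = r1 -> complex.Re (g z) <= c) ->
  complex.Re (g p) <= c.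
Proof.
move=> r10 r12 dg /continuous_cmodP cg gc; apply/ler_addgt0Pr => e e0.
have [d d0 gd] := cg _ e0.
(* The rectangle [[a, b] x [0, 2 pi]] is the annulus between the given circle and one so small that
   [g] is within [e] of [g p] there; the minimum secures [a <= b]. *)
pose X := ln r2; pose b := ln r1; pose a := Num.min b (ln (d / 2)).
have expX : expR X = r2 by rewrite lnK// posrE (lt_trans r10).
have expb : expR b = r1 by rewrite lnK// posrE.
have ab : a <= b by rewrite ge_min lexx.
have bX : b < X by rewrite ltr_ln// posrE (lt_trans r10).
have ad : expR a < d.
  apply: (@le_lt_trans _ _ (expR (ln (d / 2)))); first by rewrite ler_expR ge_min lexx orbT.
  by rewrite lnK ?posrE ?divr_gt0//; lra.
pose u s t := complex.Re (g (p + cexp s t)); pose v s t := complex.Im (g (p + cexp s t)).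
have uv s t : s < X -> closed_at v u s t.
  move=> sX; apply: holomorphic_polar_closed; apply: dg; rewrite addrC addKr cmod_cexp.
    exact: expR_gt0.
  by rewrite -expX ltr_expR.
have pi2 : (0 : R) <= pi *+ 2 by rewrite mulrn_wge0// pi_ge0.
have := circulation_eq0 uv ab pi2 bX.
rewrite /circulation.
under eq_Rintegral do rewrite /v cexp_2pi subrr.
rewrite Rintegral_itv_cst// mul0r add0r => I0.
have cu s : s < X -> {in `[0, pi *+ 2], continuous (u s)}.
  by move=> sX t _; apply: (closed_at_continuous (closed_at_sym (uv _ t sX))).
have : 0 <= (c - complex.Re (g p) + e) * (pi *+ 2 - 0).
  rewrite -[leLHS]I0 -Rintegral_itv_cst//; apply: le_Rintegral => //.
  - apply: continuous_itv_integrable => t tI; apply: continuousB; apply: cu tI => //.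
    exact: le_lt_trans bX.
  - by apply: continuous_itv_integrable => t tI; exact: cst_continuous.
  - move=> t tI.
    have : u b t <= c by apply: gc; rewrite addrC addKr cmod_cexp.
    have : cmod (g (p + cexp a t) - g p) < e by apply: gd; rewrite addrC addKr cmod_cexp.
    move=> /(le_lt_trans (ler_Re_cmod _)); rewrite cReD cReN -/(u a t).
    by rewrite ltr_norml => /andP[? ?] ?; lra.
rewrite subr0 pmulr_lge0; last by rewrite pmulrn_lgt0// pi_gt0.
by lra.
Qed.

End Polar.

Section MaximumPrinciple.
Variable R : realType.
Local Notation C := (R[i]^o).
Implicit Types (z p : R[i]) (g : R[i] -> R[i]) (K : set C).

Lemma continuous_cplx : continuous (fun q : R * R => (q.1 +i* q.2 : C)).
Proof.
move=> [x y] A /nbhs_cmodP[e e0 eA].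
have e20 : 0 < e / 2 by rewrite divr_gt0.
exists (ball x (e / 2), ball y (e / 2)).
  by split; apply: nbhsx_ballx.
move=> [x' y'] [/= + +]; rewrite -!ball_normE /= => xx yy; apply: eA.
rewrite (le_lt_trans (cmod_le_ReIm _))//= -!(distrC x) -!(distrC y); lra.
Qed.

Lemma continuous_real_cmod (f : R[i] -> R) z :
  (forall e : R, 0 < e -> exists2 d : R, 0 < d &
     forall y, cmod (y - z) < d -> `|f y - f z| < e) ->
  {for z, continuous (f : C -> R)}.
Proof.
move=> H A /nbhs_ballP[e /= /H[d d0 dH] eA]; apply/nbhs_cmodP; exists d => // y yz.
by apply: eA; rewrite -ball_normE /= distrC dH.
Qed.

Lemma continuous_cmod : continuous (fun z : C => cmod z).
Proof.
move=> z; apply: continuous_real_cmod => e e0; exists e => // y yz.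
rewrite ltr_norml; have := cmodB_ge z y; have := cmodB_ge y z.
by rewrite (cmodBC z y) => ? ?; apply/andP; split; lra.
Qed.

Lemma compact_cmod_le K (M : R) : closed K -> (forall z, K z -> cmod z <= M) ->
  compact K.
Proof.
move=> cK KM; pose S := `[(- M), M]%classic `*` `[(- M), M]%classic.
apply: (@subclosed_compact _ K ((fun q : R * R => (q.1 +i* q.2 : C)) @` S)) => //.
  apply: continuous_compact; last first.
    by apply: compact_setX; exact: segment_compact.
  by apply: continuous_subspaceT; exact: continuous_cplx.
move=> [x y] /KM zM; exists (x, y) => //; split; rewrite /= in_itv/= -ler_norml.
  exact: le_trans (ler_Re_cmod (x +i* y)) zM.
exact: le_trans (ler_Im_cmod (x +i* y)) zM.
Qed.

Lemma continuous_Re_comp g p : ccontinuous_at g p ->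
  {for p, continuous (fun z : C => complex.Re (g z))}.
Proof.
move=> /continuous_cmodP gp; apply: continuous_real_cmod => e /gp[d d0 dH].
exists d => // y /dH; by apply: le_lt_trans; rewrite -cReN -cReD ler_Re_cmod.
Qed.

(** Adding a small multiple of [|z|^2] makes the real part strictly subharmonic, so the maximum over
    [K] can only sit where the bound is assumed. The punctured discs admit isolated points at which
    [g] is merely continuous. *)
Lemma Re_max_principle K g (M : R) : compact K ->
  (forall p, K p -> ccontinuous_at g p) ->
  (forall p, K p -> complex.Re (g p) <= M \/
     exists2 r, 0 < r & forall z, cmod (z - p) < r ->
       K z /\ (0 < cmod (z - p) -> holomorphic_at g z)) ->
  forall p, K p -> complex.Re (g p) <= M.
Proof.
move=> cK cg gM p Kp; have K0 : K !=set0 by exists p.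
have [|b bK Bb] := @compact_EVT_max _ R (fun z : C => cmod z) K K0 cK.
  by apply: continuous_subspaceT; exact: continuous_cmod.
apply/ler_addgt0Pr => e e0; set B := cmod b.
have B0 : 0 < B ^+ 2 + 1 by rewrite ltr_wpDl// sqr_ge0.
pose d := e / (B ^+ 2 + 1).
have d0 : 0 < d by rewrite divr_gt0.
pose u (z : C) := complex.Re (g z) + d * cmod z ^+ 2.
have [|q qK uq] := @compact_EVT_max _ R u K K0 cK.
  apply: continuous_in_subspaceT => z /set_mem zK.
  apply: (@continuousD _ _ _ (fun z : C => complex.Re (g z)) (fun z : C => d * cmod z ^+ 2)).
    exact: continuous_Re_comp (cg _ zK).
  apply: (@continuousM _ _ (fun=> d) (fun z : C => cmod z ^+ 2)).
    exact: cst_continuous.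
  apply: (@continuous_comp _ _ _ (fun z : C => cmod z) (fun x : R => x ^+ 2)).
    exact: continuous_cmod.
  exact: exprn_continuous.
have {}uq z : K z -> u z <= u q by move=> /mem_set; exact: uq.
have qB : d * cmod q ^+ 2 <= e.
  apply: (@le_trans _ _ (d * B ^+ 2)).
    by rewrite ler_pM2l// lerXn2r ?nnegrE ?cmod_ge0//; exact: Bb.
  by rewrite /d mulrAC ler_pdivrMr// ler_pM2l// lerDl.
have pu : complex.Re (g p) <= u p by rewrite lerDl mulr_ge0 ?(ltW d0)// sqr_ge0.
have [gqM|[r r0 Hr]] := gM q (set_mem qK).
  by apply: le_trans pu _; apply: le_trans (uq _ Kp) _; rewrite lerD.
(* Re (G z) = u z - d (|q|^2 + |z - q|^2): on circles around the maximum point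
   [q] of [u], Re G is smaller than at the center by a fixed amount. *)
exfalso; pose G z := g z + (2 * d)%:C * conjc q * (z - q).
have r20 : 0 < r / 2 by rewrite divr_gt0.
have r2r : r / 2 < r by lra.
have dG z : holomorphic_at g z -> holomorphic_at G z.
  move=> dg; apply: holomorphic_atD; first exact: dg.
  apply: holomorphic_atM.
    exact: holomorphic_at_cst.
  by apply: holomorphic_atB; [exact: holomorphic_at_id|exact: holomorphic_at_cst].
have : complex.Re (G q) <= complex.Re (g q) - d * (r / 2) ^+ 2.
  apply: (@center_le_of_circle_le _ _ _ (r / 2) r) => //.
  - by move=> z z0 /Hr[_ /(_ z0)]; exact: dG.
  - apply: ccontinuous_atD; first exact/cg/set_mem.
    apply/holomorphic_at_continuous/holomorphic_atM; first exact: holomorphic_at_cst.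
    by apply: holomorphic_atB; [exact: holomorphic_at_id|exact: holomorphic_at_cst].
  - move=> z zr; have [] := Hr z; first by rewrite zr.
    move=> /uq; rewrite /u -zr => + _.
    rewrite !sqr_cmod /G cReD cReM cReM cImM cReJ cImJ !cReD !cImD !cReN !cImN /=.
    by lra.
rewrite /G subrr mulr0 addr0.
have : 0 < d * (r / 2) ^+ 2 by rewrite mulr_gt0// exprn_gt0.
lra.
Qed.

(** The factor [conjc (g p)] rotates the value at [p] to the positive number [cmod (g p) ^+ 2],
    which reduces moduli to real parts. *)
Lemma maximum_modulus K g (M : R) : compact K -> 0 <= M ->
  (forall p, K p -> ccontinuous_at g p) ->
  (forall p, K p -> cmod (g p) <= M \/
     exists2 r, 0 < r & forall z, cmod (z - p) < r ->
       K z /\ (0 < cmod (z - p) -> holomorphic_at g z)) ->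
  forall p, K p -> cmod (g p) <= M.
Proof.
move=> cK M0 cg gM p Kp.
have [gp0|gp0] := eqVneq (g p) 0; first by rewrite gp0 cmod0.
have gp : 0 < cmod (g p) by rewrite cmod_gt0.
suff : complex.Re (conjc (g p) * g p) <= cmod (g p) * M.
  have -> : complex.Re (conjc (g p) * g p) = cmod (g p) * cmod (g p).
    by rewrite -expr2 sqr_cmod; case: (g p) => a b /=; ring.
  by rewrite ler_pM2l.
apply: (@Re_max_principle K (fun z => conjc (g p) * g z) _ cK _ _ _ Kp).
  by move=> z /cg; apply: ccontinuous_atM; exact: ccontinuous_at_cst.
move=> z Kz; have [gz|[r r0 rH]] := gM z Kz; [left|right].
  apply: le_trans (ler_norm _) (le_trans (ler_Re_cmod _) _).
  by rewrite cmodM cmod_conj ler_pM2l.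
exists r; first exact: r0.
move=> y /rH[Ky dy]; split; first exact: Ky.
move=> /dy dgy; apply: holomorphic_atM; [exact: holomorphic_at_cst|exact: dgy].
Qed.

End MaximumPrinciple.

(** * Schwarz-Pick, Harnack and Julia in the right half-plane *)

Section SchwarzPick.
Variable R : realType.
Local Notation C := (R[i]^o).
Implicit Types (z a b : R[i]) (h : R[i] -> R[i]).

Definition right_half_self h :=
  (forall z, 0 < complex.Re z -> 0 < complex.Re (h z)) /\
  (forall z, 0 < complex.Re z -> holomorphic_at h z).

Lemma cmodB_lt_cmodDJ z a : 0 < complex.Re z -> 0 < complex.Re a ->
  cmod (z - a) < cmod (z + conjc a).
Proof.
move=> z0 a0; rewrite -(@ltr_pXn2r _ 2)// ?nnegrE ?cmod_ge0//.
by rewrite sqr_cmodDJ ltrDl mulr_gt0// mulr_gt0.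
Qed.

Section PseudoDisk.
Variables (a : R[i]) (r : R).
Hypotheses (a0 : 0 < complex.Re a) (r0 : 0 < r) (r1 : r < 1).

(* The closed hyperbolic disc around [a] of pseudo-hyperbolic radius [r]. *)
Definition pseudo_disk : set C := [set z | cmod (z - a) <= r * cmod (z + conjc a)].

Let defect z := r * cmod (z + conjc a) - cmod (z - a).

Let defect_lip y z : `|defect y - defect z| <= 2 * cmod (y - z).
Proof.
have y1 := cmodB_ge (y + conjc a) (z + conjc a); have y2 := cmodB_ge (z + conjc a) (y + conjc a).
have y3 := cmodB_ge (y - a) (z - a); have y4 := cmodB_ge (z - a) (y - a).
have E1 : y + conjc a - (z + conjc a) = y - z by ring.
have E2 : z + conjc a - (y + conjc a) = z - y by ring.
have E3 : y - a - (z - a) = y - z by ring.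
have E4 : z - a - (y - a) = z - y by ring.
move: y1 y2 y3 y4; rewrite E1 E2 E3 E4 (cmodBC z y) /defect.
set A := cmod _; set B := cmod _; set D := cmod _ => AB BA y3 y4.
have rAB : r * (A - B) <= D.
  have D0 : 0 <= D by exact: cmod_ge0.
  apply: le_trans (ler_wpM2l (ltW r0) AB) _.
  by rewrite ler_piMl// ltW.
have rBA : r * (B - A) <= D.
  have D0 : 0 <= D by exact: cmod_ge0.
  apply: le_trans (ler_wpM2l (ltW r0) BA) _.
  by rewrite ler_piMl// ltW.
by rewrite ler_norml; apply/andP; split; lra.
Qed.

Lemma pseudo_disk_closed : closed pseudo_disk.
Proof.
have -> : pseudo_disk = defect @^-1` [set x | 0 <= x].
  by apply/seteqP; split=> z /=; rewrite subr_ge0.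
apply: closed_comp; last exact: closed_ge.
move=> z _; apply: continuous_real_cmod => e e0; exists (e / 2); first by rewrite divr_gt0.
by move=> y yz; apply: le_lt_trans (defect_lip y z) _; lra.
Qed.

(** Where [Re z <= 0], the reflected point [- conjc a] is at most as far from [z] as [a] is; then
    [r < 1] forces [z = a], against [0 < Re a]. *)
Lemma pseudo_disk_right_half z : pseudo_disk z -> 0 < complex.Re z.
Proof.
rewrite /pseudo_disk /= => zK; rewrite ltNge; apply/negP => z0.
have : cmod (z + conjc a) <= cmod (z - a).
  rewrite -(@ler_pXn2r _ 2)// ?nnegrE ?cmod_ge0//.
  by rewrite sqr_cmodDJ gerDl pmulr_rle0// pmulr_lle0.
have := cmod_ge0 (z + conjc a) => A0 A1.
have : cmod (z - a) <= 0.
  have : r * cmod (z + conjc a) <= r * cmod (z - a) by rewrite ler_pM2l.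
  have : 0 <= (1 - r) * cmod (z - a) by rewrite mulr_ge0 ?cmod_ge0// subr_ge0 ltW.
  move=> H1 H2; have : (1 - r) * cmod (z - a) <= 0 by lra.
  by rewrite pmulr_rle0// subr_gt0.
rewrite le_eqVlt ltNge cmod_ge0 orbF cmod_eq0 subr_eq0 => /eqP za.
by move: z0; rewrite za leNgt a0.
Qed.

Lemma pseudo_disk_compact : compact pseudo_disk.
Proof.
(* From [|z| - |a| <= r (|z| + |a|)] follows [(1 - r) |z| <= (1 + r) |a| <= 2 |a|]. *)
apply: (@compact_cmod_le _ _ (2 * cmod a / (1 - r))); first exact: pseudo_disk_closed.
move=> z; rewrite /pseudo_disk /= => zK; rewrite ler_pdivlMr ?subr_gt0//.
have := cmodB_ge z a; have := cmodD z (conjc a); rewrite cmod_conj => H1 H2.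
have := ler_wpM2l (ltW r0) H1.
have : r * cmod a <= cmod a by rewrite ler_piMl ?cmod_ge0// ltW.
lra.
Qed.

Lemma pseudo_disk_interior z : cmod (z - a) < r * cmod (z + conjc a) ->
  exists2 d, 0 < d & forall y, cmod (y - z) < d -> pseudo_disk y.
Proof.
move=> zK; exists (defect z / 2); first by rewrite divr_gt0// subr_gt0.
move=> y yz; rewrite /pseudo_disk /= -subr_ge0 -/(defect y).
by have := defect_lip y z; rewrite ler_norml => /andP[? ?]; lra.
Qed.

End PseudoDisk.

Section Quotient.
Variables (h : R[i] -> R[i]) (a : R[i]).
Hypotheses (hh : right_half_self h) (a0 : 0 < complex.Re a).

Let slope_ex := holomorphic_at_expansion (hh.2 a a0).
Let slope := sval (cid slope_ex).

(** The derivative as value at [a] gives continuity there. The point [a] is then an exceptional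
    center in the maximum principle, and discs around other points are chosen to avoid it. *)
Let q z := if z == a then slope else (h z - h a) / (z - a).

(* The quotient of the pseudo-distances, extended to [a] by continuity. *)
Let g z := q z * (z + conjc a) * (h z + conjc (h a))^-1.

Let holo_q z : 0 < complex.Re z -> z != a -> holomorphic_at q z.
Proof.
move=> z0 za; have za0 : 0 < cmod (z - a) by rewrite cmod_gt0 subr_eq0.
apply: (@holomorphic_at_near _ (fun z => (h z - h a) / (z - a)) q z _ za0).
  move=> y yz; rewrite /q; case: eqP yz => // ->.
  by rewrite cmodBC ltxx.
apply: holomorphic_atM.
  by apply: holomorphic_atB; [exact: hh.2|exact: holomorphic_at_cst].
apply: holomorphic_atV; first by rewrite subr_eq0.
by apply: holomorphic_atB; [exact: holomorphic_at_id|exact: holomorphic_at_cst].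
Qed.

Let cont_q : ccontinuous_at q a.
Proof.
apply/continuous_cmodP => e e0; rewrite /q eqxx /slope.
case: cid => l /= Hl; have e20 : 0 < e / 2 by rewrite divr_gt0.
have [d d0 dH] := Hl _ e20; exists d => // y yd.
case: (eqVneq y a) => [_|ya]; first by rewrite subrr cmod0.
have ya0 : 0 < cmod (y - a) by rewrite cmod_gt0 subr_eq0.
have -> : (h y - h a) / (y - a) - l = (h y - h a - l * (y - a)) / (y - a).
  by field; rewrite subr_eq0.
rewrite cmodM cmodV ltr_pdivrMr//.
apply: le_lt_trans (dH _ yd) _; rewrite ltr_pM2r//; lra.
Qed.

Let hz_neq0 z : 0 < complex.Re z -> h z + conjc (h a) != 0.
Proof.
move=> z0; apply/eqP => /(congr1 (@complex.Re R)).
rewrite cReD cReJ /=; have := hh.1 _ z0; have := hh.1 _ a0; lra.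
Qed.

Let holo_rest z : 0 < complex.Re z ->
  holomorphic_at (fun z => (h z + conjc (h a))^-1) z.
Proof.
move=> z0; apply: holomorphic_atV; first exact: hz_neq0.
by apply: holomorphic_atD; [exact: hh.2|exact: holomorphic_at_cst].
Qed.

Let holo_lin z : holomorphic_at (fun z => z + conjc a) z.
Proof. by apply: holomorphic_atD; [exact: holomorphic_at_id|exact: holomorphic_at_cst]. Qed.

Let holo_g z : 0 < complex.Re z -> z != a -> holomorphic_at g z.
Proof.
move=> z0 za; apply: holomorphic_atM; last exact: holo_rest.
by apply: holomorphic_atM; [exact: holo_q|exact: holo_lin].
Qed.

Let cont_g z : 0 < complex.Re z -> ccontinuous_at g z.
Proof.
move=> z0; have [->|za] := eqVneq z a; last exact/holomorphic_at_continuous/holo_g.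
apply: ccontinuous_atM; last exact/holomorphic_at_continuous/holo_rest.
by apply: ccontinuous_atM; [exact: cont_q|exact/holomorphic_at_continuous/holo_lin].
Qed.

(** On the rim the pseudo-distance from [a] is exactly [r], while the one between the images is
    below 1; the maximum principle carries the resulting bound [1 / r] inside. *)
Let g_le r z : 0 < r -> r < 1 -> pseudo_disk a r z -> cmod (g z) <= r^-1.
Proof.
move=> r0 r1; apply: maximum_modulus.
- exact: pseudo_disk_compact.
- by rewrite invr_ge0 ltW.
- by move=> p pK; apply: cont_g; apply: (pseudo_disk_right_half a0 r0 r1 pK).
move=> p pK; have p0 := pseudo_disk_right_half a0 r0 r1 pK.
have hp0 := hh.1 _ p0; have ha0 := hh.1 _ a0.
have pa := cmodB_lt_cmodDJ p0 a0.
have pa0 : 0 < cmod (p + conjc a) by exact: le_lt_trans (cmod_ge0 _) pa.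
move: (pK); rewrite /pseudo_disk /= le_eqVlt => /orP[/eqP pr|pr]; [left|right].
  have pna : p != a.
    rewrite -subr_eq0 -cmod_eq0 pr gt_eqF//; exact: mulr_gt0.
  rewrite /g /q (negbTE pna) !cmodM !cmodV pr.
  have hpa := cmodB_lt_cmodDJ hp0 ha0.
  have hpa0 : 0 < cmod (h p + conjc (h a)) by exact: le_lt_trans (cmod_ge0 _) hpa.
  rewrite ler_pdivrMr// invfM mulrA mulfVK ?gt_eqF// mulrC ler_pM2l ?invr_gt0//.
  exact: ltW.
have [d d0 dH] := pseudo_disk_interior r0 r1 pr.
have [pa'|pna] := eqVneq p a.
  exists d; first exact: d0.
  move=> {}z zp; split; first exact: dH.
  rewrite cmod_gt0 subr_eq0 pa' => za; apply: holo_g => //.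
  exact: (pseudo_disk_right_half a0 r0 r1 (dH _ zp)).
exists (Num.min d (cmod (p - a))); first by rewrite lt_min d0 cmod_gt0 subr_eq0.
move=> {}z; rewrite lt_min => /andP[zp zpa]; split; first exact: dH.
move=> _; apply: holo_g.
  exact: (pseudo_disk_right_half a0 r0 r1 (dH _ zp)).
by apply/eqP => za; move: zpa; rewrite za cmodBC ltxx.
Qed.

Lemma schwarz_pick b : 0 < complex.Re b ->
  cmod (h b - h a) * cmod (b + conjc a) <= cmod (h b + conjc (h a)) * cmod (b - a).
Proof.
move=> b0; have [->|ba] := eqVneq b a; first by rewrite !subrr !cmod0 mul0r mulr0.
have bl := cmodB_lt_cmodDJ b0 a0.
have bB : 0 < cmod (b - a) by rewrite cmod_gt0 subr_eq0.
have bD : 0 < cmod (b + conjc a) by exact: lt_trans bl.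
have hD : 0 < cmod (h b + conjc (h a)) by rewrite cmod_gt0 hz_neq0.
set X := _ * _; set Y := _ * _.
have Y0 : 0 < Y by rewrite mulr_gt0.
have main r : 0 < r -> r < 1 -> cmod (b - a) <= r * cmod (b + conjc a) -> r * X <= Y.
  move=> r0 r1 /(g_le r0 r1); rewrite /g /q (negbTE ba) !cmodM !cmodV.
  move=> /(ler_wpM2l (ltW r0)); rewrite (mulfV (lt0r_neq0 r0)) => H.
  have {}H := ler_wpM2r (ltW Y0) H; rewrite mul1r in H; apply: le_trans H.
  rewrite le_eqVlt /X /Y; apply/orP; left; apply/eqP; field.
  by rewrite !gt_eqF.
rewrite leNgt; apply/negP => YX; have X0 := lt_trans Y0 YX.
(* The radius [(1 + m) / 2] lies strictly between [m] and 1: the disc contains [b], and [r X <= Y]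
   contradicts [r > Y / X]. This replaces the limit [r -> 1]. *)
pose m := Num.max (cmod (b - a) / cmod (b + conjc a)) (Y / X).
have m1 : m < 1 by rewrite gt_max !ltr_pdivrMr// !mul1r bl.
have ml1 : cmod (b - a) / cmod (b + conjc a) <= m by rewrite le_max lexx.
have ml2 : Y / X <= m by rewrite le_max lexx orbT.
have m0 : 0 < m by apply: lt_le_trans ml2; rewrite divr_gt0.
have := main ((1 + m) / 2) ltac:(lra) ltac:(lra).
rewrite -ler_pdivrMr// => /(_ ltac:(lra)).
rewrite -ler_pdivlMr//; lra.
Qed.

End Quotient.
End SchwarzPick.

Section HalfPlane.
Variable R : realType.
Implicit Types (z a b : R[i]) (h f : R[i] -> R[i]).

(** After squaring, [sqr_cmodDJ] expands both sums, and the product of the two squared distances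
    cancels from the two sides. *)
Lemma schwarz_pick_sqr h a b : right_half_self h ->
  0 < complex.Re a -> 0 < complex.Re b ->
  cmod (h b - h a) ^+ 2 * (complex.Re b * complex.Re a) <=
  cmod (b - a) ^+ 2 * (complex.Re (h b) * complex.Re (h a)).
Proof.
move=> hh a0 b0.
have := schwarz_pick hh a0 b0; rewrite -(@ler_pXn2r _ 2)// ?nnegrE ?mulr_ge0 ?cmod_ge0//.
rewrite !exprMn !sqr_cmodDJ; lra.
Qed.

Lemma harnack f a b : (forall z, 0 < complex.Re z -> 0 <= complex.Re (f z)) ->
  (forall z, 0 < complex.Re z -> holomorphic_at f z) ->
  0 < complex.Re a -> 0 < complex.Re b ->
  cmod (f b) * (complex.Re a * complex.Re b) <= cmod (f a) * (cmod a + cmod b) ^+ 2.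
Proof.
move=> f0 df a0 b0; set X := complex.Re a * _; set Y := _ ^+ 2.
have X0 : 0 < X by rewrite mulr_gt0.
have Y0 : 0 <= Y by rewrite sqr_ge0.
(* [right_half_self] requires a strictly positive real part, so [f] is shifted by [n]; the shift
   costs [n * (X + Y)], which is below [e]. *)
apply/ler_addgt0Pr => e e0; pose n := e / (X + Y + 1).
have XY1 : 0 < X + Y + 1 by lra.
have n0 : 0 < n by rewrite divr_gt0.
have nE : n * (X + Y + 1) = e by rewrite /n mulfVK// gt_eqF.
pose h z := f z + n%:C.
have hh : right_half_self h.
  split => z z0; first by rewrite /h cReD /=; have := f0 z z0; lra.
  by apply: holomorphic_atD; [exact: df|exact: holomorphic_at_cst].
have := schwarz_pick_sqr hh a0 b0.
have hbf : cmod (f b) - n <= cmod (h b).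
  have := cmodB_ge (f b) (- n%:C); rewrite cmodN cmodR gtr0_norm// opprK; exact.
have haf : cmod (h a) <= cmod (f a) + n.
  by rewrite (le_trans (cmodD _ _))// cmodR gtr0_norm.
have DAB : (cmod (h b) - cmod (h a)) ^+ 2 <= cmod (h b - h a) ^+ 2.
  rewrite -(real_normK (num_real (cmod (h b) - _))) lerXn2r ?nnegrE ?cmod_ge0//.
  by rewrite ler_norml cmodB_ge andbT lerNl opprB cmodBC cmodB_ge.
have [hb0 ha0] := (hh.1 b b0, hh.1 a a0).
have EA := le_trans (ler_norm _) (ler_Re_cmod (h a)).
have EB := le_trans (ler_norm _) (ler_Re_cmod (h b)).
have EAB : complex.Re (h b) * complex.Re (h a) <= cmod (h b) * cmod (h a).
  by rewrite ler_pM// ltW.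
have dY : cmod (b - a) ^+ 2 + 4 * X <= Y.
  rewrite /X [complex.Re a * _]mulrC -sqr_cmodDJ lerXn2r ?nnegrE ?cmod_ge0 ?addr_ge0 ?cmod_ge0//.
  by rewrite (le_trans (cmodD _ _))// cmod_conj addrC.
rewrite [complex.Re b * complex.Re a]mulrC -/X.
set A := cmod (h b) in hbf DAB EAB EB *; set B := cmod (h a) in haf DAB EAB EA *.
have A0 : 0 < A by exact: lt_le_trans EB.
have B0 : 0 < B by exact: lt_le_trans EA.
set dd := cmod (b - a) ^+ 2 in dY *; have dd0 : 0 <= dd by rewrite sqr_ge0.
set D := cmod _ ^+ 2 in DAB *; set E := _ * complex.Re (h a) in EAB *.
move=> DE.
(* Schwarz-Pick becomes quadratic in the moduli: expanding the square, dropping [B ^+ 2 * X] and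
   dividing by [A] gives [A X <= B (dd + 2 X)], and [dd + 2 X <= Y]. *)
have H1 : (A - B) ^+ 2 * X <= dd * (A * B).
  apply: le_trans (le_trans DE _); first by rewrite ler_pM2r.
  by rewrite ler_wpM2l.
have H2 : A * (A * X) <= A * (B * (dd + 2 * X)).
  have : 0 <= B ^+ 2 * X by rewrite mulr_ge0 ?sqr_ge0// ltW.
  rewrite sqrrB !mulrDl in H1 *; move: H1; rewrite expr2 -mulr_natl => H1 H2; lra.
have {}H2 : A * X <= B * Y.
  rewrite ler_pM2l// in H2; apply: le_trans H2 _.
  rewrite ler_pM2l//; lra.
have H3 : (cmod (f b) - n) * X <= (cmod (f a) + n) * Y.
  apply: le_trans (le_trans H2 _); first by rewrite ler_pM2r.
  by rewrite ler_wpM2r.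
have : 0 < n by []; move: H3; rewrite -nE; lra.
Qed.

(** Schwarz-Pick is applied to [z] and a large real point [X]; after division by the powers of [X],
    only the ratio to [W X] survives. The shift [c] comes from the charts: [T + c] is a multiple of
    [1 / (z - s)], so the ratio with [c] is the difference quotient at [s]. *)
Lemma julia (W : R[i] -> R[i]) (l : R[i]) (c : R) : right_half_self W ->
  0 <= c -> complex.Re l <= 1 ->
  (forall e M : R, 0 < e -> exists2 X : R, M < X &
     cmod ((X + c)%:C / (W X%:C + c%:C) - l) < e) ->
  forall z, 0 < complex.Re z -> complex.Re z <= complex.Re (W z).
Proof.
move=> hW c0 l1 HX z z0; rewrite leNgt; apply/negP.
set x := complex.Re z in z0 *; set w := complex.Re (W z) => wx.
have w0 : 0 < w by exact: hW.1.
(* The estimates end in [(1 - 3 e) x <= (1 + 7 e) w], so [x - w <= 3 e x + 7 e w < 10 e x], which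
   this choice contradicts. *)
pose e := (x - w) / (10 * x).
have e0 : 0 < e by rewrite divr_gt0 ?subr_gt0// mulr_gt0.
have ex : e * (10 * x) = x - w by rewrite /e mulfVK// mulf_neq0// gt_eqF.
have e1 : e < 1.
  by rewrite /e ltr_pdivrMr ?mulr_gt0//; lra.
clearbody e.
have cl := cmod_ge0 l; have cz := cmod_ge0 z; have cW := cmod_ge0 (W z).
pose k := c + cmod (W z).
have k0 : 0 <= k by rewrite addr_ge0.
(* Each summand makes one fixed quantity negligible: [c], [cmod z] and [k * (cmod l + 1)] are all at
   most [e * X]. *)
have [X] := HX e (c / e + cmod z / e + k * (cmod l + 1) / e) e0.
have ce0 : 0 <= c / e by rewrite divr_ge0// ltW.
have ze0 : 0 <= cmod z / e by rewrite divr_ge0// ltW.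
have ke0 : 0 <= k * (cmod l + 1) / e by rewrite divr_ge0 ?(ltW e0)// mulr_ge0//; lra.
move=> Xbig; set U := W X%:C; set m := _ / _ => ml.
have X0 : 0 < X by lra.
have cX : c <= e * X by rewrite [e * X]mulrC -ler_pdivrMr//; lra.
have zX : cmod z <= e * X by rewrite [e * X]mulrC -ler_pdivrMr//; lra.
have kX : k * (cmod l + 1) <= e * X by rewrite [e * X]mulrC -ler_pdivrMr//; lra.
move: Xbig => _.
have XR : complex.Re X%:C = X by [].
have U0 : 0 < complex.Re U by apply: hW.1.
set U' := U + c%:C in m ml *; set X' := X + c in m ml *.
have U'E : complex.Re U' = complex.Re U + c by rewrite /U' cReD.
have U'0 : 0 < complex.Re U' by rewrite U'E; lra.
have T0 : 0 < cmod U'.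
  by apply: lt_le_trans (le_trans (ler_norm _) (ler_Re_cmod U')).
have X'0 : 0 < X' by rewrite /X'; lra.
(* As [m = X' / U'], its real part is [X' Re U' / |U'|^2]; this is where [Re l <= 1] enters. *)
have mRe : X' * complex.Re U' <= (1 + e) * cmod U' ^+ 2.
  have -> : X' * complex.Re U' = complex.Re m * cmod U' ^+ 2.
    rewrite /m cReM cReV /= mul0r subr0 -mulrA mulfVK// expf_neq0// gt_eqF//.
  rewrite ler_pM2r ?exprn_gt0//.
  have := le_lt_trans (le_trans (ler_norm _) (ler_Re_cmod _)) ml.
  by rewrite cReD cReN; lra.
have mT : X' <= (cmod l + 1) * cmod U'.
  have -> : X' = cmod m * cmod U'.
    by rewrite /m cmodM cmodV cmodR gtr0_norm// mulfVK// gt_eqF.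
  rewrite ler_pM2r//; have := cmodB_ge m l; lra.
have kT : k <= e * cmod U'.
  have l10 : 0 < cmod l + 1 by lra.
  rewrite -(ler_pM2r l10); apply: le_trans kX _.
  rewrite -mulrA ler_pM2l// mulrC; apply: le_trans mT; rewrite /X'; lra.
set T := cmod U' in T0 mRe mT kT.
have low : (1 - e) * T <= cmod (U + conjc (W z)).
  have := cmodB_ge U (- conjc (W z)); rewrite cmodN cmod_conj opprK.
  have : T <= cmod U + c by rewrite /T /U' (le_trans (cmodD _ _))// cmodR ger0_norm.
  rewrite mulrBl mul1r; move: kT; rewrite /k; lra.
have up : cmod (X%:C + conjc z) <= (1 + e) * X'.
  rewrite (le_trans (cmodD _ _))// cmodR cmod_conj gtr0_norm// /X'.
  have : 0 <= e * c by rewrite mulr_ge0// ltW.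
  lra.
have SP : cmod (U + conjc (W z)) ^+ 2 * (X * x) <=
    cmod (X%:C + conjc z) ^+ 2 * (complex.Re U * w).
  have := @schwarz_pick_sqr W z X%:C hW z0 X0; rewrite !sqr_cmodDJ -/U -/x -/w /=; lra.
have SP' : ((1 - e) * T) ^+ 2 * (X * x) <= ((1 + e) * X') ^+ 2 * (complex.Re U' * w).
  have e10 : 0 <= 1 - e by lra.
  have e20 : 0 <= 1 + e by lra.
  apply: (@le_trans _ _ (cmod (U + conjc (W z)) ^+ 2 * (X * x))).
    rewrite ler_wpM2r// ?lerXn2r ?nnegrE ?cmod_ge0//; first by rewrite mulr_ge0// ltW.
    by rewrite mulr_ge0// ltW.
  apply: le_trans SP _; rewrite ler_pM//.
  - exact: sqr_ge0.
  - by rewrite mulr_ge0// ltW.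
  - by rewrite lerXn2r ?nnegrE ?cmod_ge0// mulr_ge0// ltW.
  - by rewrite ler_pM2r// U'E lerDl.
have XX' : (1 - e) * X' <= X.
  have : 0 <= e * c by rewrite mulr_ge0// ltW.
  by rewrite /X'; lra.
have e10 : 0 < 1 - e by lra.
have e20 : 0 < 1 + e by lra.
(* A further factor [X'] turns [Re U'] on the right into [X' Re U'], bounded by [mRe]; all powers of
   [T] and [X'] then cancel. *)
have main : (1 - e) ^+ 3 * x <= (1 + e) ^+ 3 * w.
  have P0 : 0 < T ^+ 2 * X' ^+ 2 by rewrite mulr_gt0// exprn_gt0.
  rewrite -(ler_pM2l P0).
  apply: (@le_trans _ _ (((1 - e) * T) ^+ 2 * (X * x) * X')).
    have -> : T ^+ 2 * X' ^+ 2 * ((1 - e) ^+ 3 * x) =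
      ((1 - e) * T) ^+ 2 * x * X' * ((1 - e) * X') by ring.
    have -> : ((1 - e) * T) ^+ 2 * (X * x) * X' = ((1 - e) * T) ^+ 2 * x * X' * X.
      by ring.
    by rewrite ler_wpM2l// !mulr_ge0 ?sqr_ge0// ltW.
  apply: (@le_trans _ _ (((1 + e) * X') ^+ 2 * (complex.Re U' * w) * X')).
    by rewrite ler_pM2r.
  have -> : ((1 + e) * X') ^+ 2 * (complex.Re U' * w) * X' =
    ((1 + e) * X') ^+ 2 * w * (X' * complex.Re U') by ring.
  have -> : T ^+ 2 * X' ^+ 2 * ((1 + e) ^+ 3 * w) =
    ((1 + e) * X') ^+ 2 * w * ((1 + e) * T ^+ 2) by ring.
  by rewrite ler_wpM2l// mulr_ge0 ?sqr_ge0// ltW.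
have l3 : 1 - 3 * e <= (1 - e) ^+ 3.
  have : 0 <= e ^+ 2 * (3 - e) by rewrite mulr_ge0 ?sqr_ge0//; lra.
  rewrite !exprS expr0; lra.
have u3 : (1 + e) ^+ 3 <= 1 + 7 * e.
  have : 0 <= e * (1 - e) * (4 + e) by rewrite !mulr_ge0 ?(ltW e0)//; lra.
  rewrite !exprS expr0; lra.
have : (1 - 3 * e) * x <= (1 + 7 * e) * w.
  apply: le_trans (le_trans main _); first by rewrite ler_pM2r.
  by rewrite ler_pM2r.
have : e * w < e * x by rewrite ltr_pM2l.
lra.
Qed.

End HalfPlane.

(** * Charts sending the Denjoy-Wolff point to infinity *)

Section Boundary.
Variable R : realType.
Local Notation C := (R[i]^o).
Implicit Types (D : domain) (z s : R[i]) (f : R[i] -> R[i]).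

Lemma dom_open D z : dom D z ->
  exists2 d : R, 0 < d & forall y, cmod (y - z) < d -> dom D y.
Proof.
case: D => /= zD.
  exists (1 - cmod z); first by rewrite subr_gt0.
  move=> y yz; have := cmodB_ge y z; lra.
exists (complex.Re z); first exact: zD.
move=> y; move/(le_lt_trans (ler_Re_cmod _)); rewrite cReD cReN ltr_norml.
by move=> /andP[? ?]; lra.
Qed.

Lemma bdry_SomeP D s : bdry D (Some s) -> ~ dom D s /\
  forall d : R, 0 < d -> exists2 z, dom D z & cmod (z - s) < d.
Proof.
move=> [cls nint]; split.
  move=> sD; apply: nint; apply: one_point_compactification_some_nbhs.
  by have [d d0 dH] := dom_open sD; apply/nbhs_cmodP; exists d.
move=> d d0.
have /cls[_ [[z zD <-] [y /= yd [yz]]]] : nbhs (Some s : sphere R)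
    (Some @` [set z | cmod (z - s) < d]).
  by apply: one_point_compactification_some_nbhs; apply/nbhs_cmodP; exists d.
by exists z => //; rewrite -yz.
Qed.

Lemma bdry_disk_Some s : bdry UnitDisk (Some s) -> cmod s = 1.
Proof.
move=> /bdry_SomeP[/= s1 H]; apply/eqP; rewrite eq_le [1 <= _]leNgt andbC.
apply/andP; split; first exact/negP.
apply/ler_addgt0Pr => e /H[z z1 zs]; have := cmodB_ge s z; rewrite cmodBC; lra.
Qed.

Lemma bdry_half_plane_Some s : bdry RightHalfPlane (Some s) -> complex.Re s = 0.
Proof.
move=> /bdry_SomeP[/= s1 H]; apply/eqP; rewrite eq_le leNgt.
apply/andP; split; first exact/negP.
apply/ler_addgt0Pr => e /H[z z1 zs].
by have := le_lt_trans (ler_Re_cmod _) zs; rewrite cReD cReN ltr_norml => /andP[? ?]; lra.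
Qed.

Lemma bdry_disk_None : ~ bdry UnitDisk (None : sphere R).
Proof.
move=> [cl _].
have cK : closed ([set z : C | cmod z <= 1]).
  apply: (@closed_comp _ _ (fun z : C => cmod z) [set x | x <= 1]); last exact: closed_le.
  by move=> z _; exact: continuous_cmod.
have /cl[_ [[z /= zD <-] [[y /= yK [yz]]|//]]] : nbhs (None : sphere R)
    ((Some @` (~` [set z : C | cmod z <= 1])) `|` [set None]).
  exists [set z : C | cmod z <= 1] => //; split => //.
  by apply: (@compact_cmod_le _ _ 1 cK).
by apply: yK; rewrite /= yz ltW.
Qed.

Lemma angular_limit_Some D s f l (k : R) :
  angular_limit D (Some s) (f : R[i] -> C) l ->
  forall e : R, 0 < e -> exists2 d : R, 0 < d &
    forall z, stolz D (Some s) k z -> cmod (z - s) < d -> cmod (f z - l) < e.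
Proof.
move=> /(_ k) H e e0.
have /H : nbhs (l : C) [set y | cmod (y - l) < e] by apply/nbhs_cmodP; exists e.
move=> [V nV VH].
have /nbhs_cmodP[d d0 dH] : nbhs (s : C) (fun z => V (Some z)) by exact: nV.
by exists d => // z zs /dH Vz; apply: (VH z).
Qed.

Lemma angular_limit_None D f l (k : R) :
  angular_limit D None (f : R[i] -> C) l ->
  forall e : R, 0 < e -> exists M : R,
    forall z, stolz D None k z -> M < cmod z -> cmod (f z - l) < e.
Proof.
move=> /(_ k) H e e0.
have /H : nbhs (l : C) [set y | cmod (y - l) < e] by apply/nbhs_cmodP; exists e.
move=> [V [/= K [cK _] KV] VH].
have [[z0 Kz0]|K0] := pselect (K !=set0); last first.
  exists 0 => z zs _; apply: (VH z); split => //; apply: KV; left; exists z => // Kz.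
  by apply: K0; exists z.
have [||b bK Bb] := @compact_EVT_max _ R (fun z : C => cmod z) K _ cK.
- by exists z0.
- by apply: continuous_subspaceT; exact: continuous_cmod.
exists (cmod b) => z zs bz; apply: (VH z); split => //.
apply: KV; left; exists z => // Kz.
by have := Bb _ (mem_set Kz); rewrite leNgt bz.
Qed.

Lemma frakU_Hol D tau f : frakU D tau f -> Hol D f.
Proof.
move=> [fid|[]//]; split => z zD; first by rewrite fid.
have [d d0 dD] := dom_open zD.
apply/holomorphic_at_derivable/(@holomorphic_at_near _ id f z d d0).
  by move=> y /dD/fid.
exact: holomorphic_at_id.
Qed.


(* [T] maps [D] onto the right half-plane and [tau] to infinity, with inverse
   [S]; the third clause is the Julia inequality. *)
Definition chart D (tau : sphere R) (T S : R[i] -> R[i]) :=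
  [/\ forall z, dom D z -> 0 < complex.Re (T z) /\ S (T z) = z,
      forall z, 0 < complex.Re z -> dom D (S z) /\ T (S z) = z,
      forall f, frakU D tau f -> right_half_self (T \o f \o S) /\
        forall z, 0 < complex.Re z -> complex.Re z <= complex.Re (T (f (S z))),
      forall x : R, 0 < x -> exists2 L : R, 0 <= L & forall z z',
        x <= complex.Re z -> x <= complex.Re z' ->
        cmod (S z - S z') <= L * cmod (z - z') &
      forall d : R, 0 < d -> exists2 L : R, 0 <= L & forall z z',
        dom D z -> dom D z' -> d <= bdist D z -> d <= bdist D z' ->
        cmod (T z - T z') <= L * cmod (z - z')].

Lemma right_half_self_conj D (T S f : R[i] -> R[i]) :
  (forall z, dom D z -> 0 < complex.Re (T z)) ->
  (forall z, 0 < complex.Re z -> dom D (S z)) ->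
  (forall z, dom D z -> holomorphic_at T z) ->
  (forall z, 0 < complex.Re z -> holomorphic_at S z) ->
  Hol D f -> right_half_self (T \o f \o S).
Proof.
move=> DT DS hT hS [Df hf]; split => z z0; first exact/DT/Df/DS.
apply: holomorphic_at_comp; last exact: hS.
apply: holomorphic_at_comp; first exact/hT/Df/DS.
exact/holomorphic_at_derivable/hf/DS.
Qed.

Lemma chart_infinity : chart RightHalfPlane None id id.
Proof.
split => //.
- move=> f fU; have rf : right_half_self (id \o f \o id).
    apply: (@right_half_self_conj RightHalfPlane) => //.
    + by move=> z _; exact: holomorphic_at_id.
    + by move=> z _; exact: holomorphic_at_id.
    + exact: frakU_Hol fU.
  split=> //; case: fU => [fid z z0|[_ _ [l [[_ fl l0] l1]]]]; first by rewrite fid.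
  have {l0}l0 : l != 0 by exact: l0.
  have [lIm lRe] : complex.Im l = 0 /\ 1 <= complex.Re l.
    by move: l1; rewrite lecE /= => /andP[/eqP -> ->].
  have cl1 : 1 <= cmod l by rewrite (le_trans lRe)// (le_trans (ler_norm _))// ler_Re_cmod.
  (* At infinity the angular derivative is the limit of [f z / z], the reciprocal of the ratio in
     [julia]; hence [l^-1], and [1 <= l] becomes the required bound. *)
  apply: (@julia _ f l^-1 0) => //.
    rewrite (le_trans (ler_norm _))// (le_trans (ler_Re_cmod _))// cmodV.
    by rewrite invf_le1// (lt_le_trans _ cl1).
  move=> e M e0; pose e' := Num.min (1 / 2) (e / 4).
  have e'0 : 0 < e' by rewrite lt_min !divr_gt0.
  have [e'1 e'e] : e' <= 1 / 2 /\ e' <= e / 4 by rewrite !ge_min !lexx orbT.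
  clearbody e'.
  (* Any aperture above 1 gives a sector containing the positive real axis. *)
  have [N HN] := angular_limit_None (2 : R) fl e'0.
  pose X := Num.max (Num.max M N) 1 + 1.
  have [MX [NX X1]] : M < X /\ N < X /\ 1 < X.
    by rewrite /X -!ltrBlDr !lt_max !ltrBlDr !ltrDl ltr01 ?orbT.
  have X0 : 0 < X by lra.
  have cX : cmod X%:C = X by rewrite cmodR gtr0_norm.
  exists X => //; rewrite !addr0.
  have : cmod (f X%:C / X%:C - l) < e'.
    apply: HN; last by rewrite cX.
    by split; [exact: X0|rewrite cX /= mulr_natl mulr2n ltrDl].
  rewrite -[X%:C / _]invf_div; set v := f X%:C / X%:C => vl.
  have v2 : 1 / 2 <= cmod v.
    have := cmodB_ge l v; rewrite cmodBC; lra.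
  have v0 : 0 < cmod v by lra.
  have cl0 : 0 < cmod l by lra.
  have -> : v^-1 - l^-1 = (l - v) / (v * l).
    by field; rewrite l0 -cmod_gt0 v0.
  rewrite cmodM cmodV cmodM cmodBC ltr_pdivrMr ?mulr_gt0//.
  have : 1 / 2 * 1 <= cmod v * cmod l by rewrite ler_pM.
  rewrite -(ler_pM2l e0) => H; apply: lt_le_trans vl _; apply: le_trans H; lra.
- by move=> x x0; exists 1 => // z z' _ _; rewrite mul1r.
- by move=> x x0; exists 1 => // z z' _ _ _ _; rewrite mul1r.
Qed.

(** This covers both domains at a finite boundary point: [w = 1], [c = 0] for the half-plane and
    [w = - s], [c = 1 / 2] for the disc. The last two hypotheses say that [S] sends large reals to
    the inner normal at [s], and that [s] is at least as far as the boundary. *)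
Lemma chart_finite D s (w : R[i]) (c : R) : cmod w = 1 -> 0 <= c ->
  (forall z, dom D z -> z != s /\ c < complex.Re (w / (z - s))) ->
  (forall z, 0 < complex.Re z -> dom D (s + w / (z + c%:C))) ->
  (forall x : R, 1 <= x -> bdist D (s + w / (x + c)%:C) = (x + c)^-1) ->
  (forall z, dom D z -> bdist D z <= cmod (z - s)) ->
  chart D (Some s) (fun z => w / (z - s) - c%:C) (fun z => s + w / (z + c%:C)).
Proof.
move=> w1 c0 DT DS Sx Dd.
have w0 : w != 0 by rewrite -cmod_eq0 w1 oner_neq0.
have zc0 z : 0 < complex.Re z -> z + c%:C != 0.
  move=> z0; apply/eqP => /(congr1 (@complex.Re R)); rewrite cReD /=; lra.
have zcle z : 0 < complex.Re z -> complex.Re z <= cmod (z + c%:C).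
  move=> z0; apply: le_trans (le_trans (ler_norm _) (ler_Re_cmod _)).
  by rewrite cReD /= lerDl.
split.
- move=> z zD; have [zs cz] := DT z zD; rewrite cReD cReN /= subr_gt0; split => //.
  rewrite subrK invf_div mulrCA mulfV// mulr1 subrKC//.
- move=> z z0; split; first exact: DS.
  by rewrite [s + _]addrC addrK invf_div mulrCA mulfV// mulr1 addrK.
- move=> f fU; have rf : right_half_self ((fun z => w / (z - s) - c%:C) \o f \o (fun z => s + w / (z + c%:C))).
    apply: (@right_half_self_conj D).
    + by move=> z zD; have [zs cz] := DT z zD; rewrite cReD cReN /= subr_gt0.
    + exact: DS.
    + move=> z zD; have [zs _] := DT z zD.
      apply: holomorphic_atB; last exact: holomorphic_at_cst.
      apply: holomorphic_atM; first exact: holomorphic_at_cst.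
      apply: holomorphic_atV; first by rewrite subr_eq0.
      by apply: holomorphic_atB; [exact: holomorphic_at_id|exact: holomorphic_at_cst].
    + move=> z z0; apply: holomorphic_atD; first exact: holomorphic_at_cst.
      apply: holomorphic_atM; first exact: holomorphic_at_cst.
      apply: holomorphic_atV; first exact: zc0.
      by apply: holomorphic_atD; [exact: holomorphic_at_id|exact: holomorphic_at_cst].
    + exact: frakU_Hol fU.
  split; first exact: rf.
  case: fU => [fid z z0|[[Df _] _ [l [[_ fl _] l1]]]].
    rewrite fid; last exact: DS.
    by rewrite [s + _]addrC addrK invf_div mulrCA mulfV// mulr1 addrK.
  apply: (julia rf c0 (l := l)).
    by move: l1; rewrite lecE /= => /andP[].
  (* For large [X] the point [z = S X] has distance [(X + c)^-1] both to [s] and to the boundary, so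
     it lies in the Stolz region of aperture 2. *)
  move=> e M e0; have [d d0 dH] := angular_limit_Some (2 : R) fl e0.
  pose X := Num.max M (Num.max 1 d^-1) + 1.
  have [MX [X1 dX]] : M < X /\ 1 < X /\ d^-1 < X.
    by rewrite /X -!ltrBlDr !lt_max !ltrBlDr !ltrDl ltr01 ?orbT.
  exists X => //=.
  have Xc0 : 0 < X + c by lra.
  have XC0 : (X + c)%:C != 0 by rewrite -cmod_eq0 cmodR normr_eq0 gt_eqF.
  clearbody X.
  have XE : X%:C + c%:C = (X + c)%:C by rewrite [RHS]rmorphD.
  rewrite subrK XE; set z := s + w / (X + c)%:C.
  have zD : dom D z by rewrite /z -XE; apply: DS => /=; lra.
  have zs : z - s = w / (X + c)%:C by rewrite /z addrC addKr.
  have czs : cmod (z - s) = (X + c)^-1 by rewrite zs cmodM cmodV w1 mul1r cmodR gtr0_norm.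
  have Xi0 : 0 < (X + c)^-1 by rewrite invr_gt0.
  have := dH z; rewrite czs => H.
  have -> : (X + c)%:C / (w / (f z - s)) = (f z - s) / (z - s).
    by rewrite zs !invf_div mulrCA.
  apply: H.
    split => //=; rewrite czs Sx; last exact: ltW.
    by rewrite mulr_natl mulr2n ltrDl.
  rewrite invf_plt ?posrE//; lra.
- move=> x x0; exists (x ^- 2); first by rewrite invr_ge0 sqr_ge0.
  move=> z z' xz xz'; have z0 := lt_le_trans x0 xz; have z'0 := lt_le_trans x0 xz'.
  have -> : s + w / (z + c%:C) - (s + w / (z' + c%:C)) =
      w * (z' - z) / ((z + c%:C) * (z' + c%:C)).
    by field; rewrite !zc0.
  rewrite !cmodM cmodV cmodM w1 mul1r cmodBC mulrC ler_wpM2r ?cmod_ge0//.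
  rewrite expr2 lef_pV2 ?posrE ?mulr_gt0 ?cmod_gt0 ?zc0//.
  rewrite ler_pM ?(ltW x0)//.
    exact: le_trans xz (zcle _ z0).
  exact: le_trans xz' (zcle _ z'0).
- move=> d d0; exists (d ^- 2); first by rewrite invr_ge0 sqr_ge0.
  move=> z z' zD z'D dz dz'; have [zs _] := DT z zD; have [z's _] := DT z' z'D.
  have -> : w / (z - s) - c%:C - (w / (z' - s) - c%:C) =
      w * (z' - z) / ((z - s) * (z' - s)).
    by field; rewrite !subr_eq0 zs z's.
  rewrite !cmodM cmodV cmodM w1 mul1r cmodBC mulrC ler_wpM2r ?cmod_ge0//.
  rewrite expr2 lef_pV2 ?posrE ?mulr_gt0 ?cmod_gt0 ?subr_eq0//.
  rewrite ler_pM ?(ltW d0)//.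
    exact: le_trans dz (Dd _ zD).
  exact: le_trans dz' (Dd _ z'D).
Qed.

Lemma chart_exists D (tau : sphere R) : bdry D tau -> exists T S, chart D tau T S.
Proof.
case: D tau => -[s|] => [/bdry_disk_Some s1|/bdry_disk_None //|/bdry_half_plane_Some s0|_]; last first.
- by exists id, id; exact: chart_infinity.
- exists (fun z => 1 / (z - s) - 0%:C), (fun z => s + 1 / (z + 0%:C)).
  apply: chart_finite => //=.
  + exact: cmod1.
  + move=> z z0; have zs : z != s by apply/eqP => zs; move: z0; rewrite zs s0 ltxx.
    split => //; rewrite div1r cReV divr_gt0 ?exprn_gt0 ?cmod_gt0 ?subr_eq0//.
    by rewrite cReD cReN s0 subr0.
  + move=> z z0; rewrite cReD s0 add0r div1r cReV addr0 divr_gt0 ?exprn_gt0 ?cmod_gt0//.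
    by apply/eqP => z0'; move: z0; rewrite z0' ltxx.
  + move=> x x1; rewrite cReD s0 add0r div1r addr0 -fmorphV//.
  + move=> z z0; apply: le_trans (le_trans (ler_norm _) (ler_Re_cmod _)).
    by rewrite cReD cReN s0 subr0.
(* Since [|s| = 1], [|z - s|^2 = 1 - 2 Re (conjc s * z) + |z|^2]; hence [|z| < 1] amounts to
   [Re (- s / (z - s)) > 1 / 2], and the shift moves this half-plane to [Re > 0]. *)
exists (fun z => - s / (z - s) - (2^-1)%:C), (fun z => s + - s / (z + (2^-1)%:C)).
have s2 : complex.Re s ^+ 2 + complex.Im s ^+ 2 = 1 by rewrite -sqr_cmod s1 expr1n.
apply: chart_finite => //=.
- by rewrite cmodN.
- move=> z z1; have zs : z != s by apply/eqP => zs; move: z1; rewrite zs s1 ltxx.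
  split => //.
  have zs0 : 0 < cmod (z - s) ^+ 2 by rewrite exprn_gt0 ?cmod_gt0 ?subr_eq0.
  have z2 : complex.Re z ^+ 2 + complex.Im z ^+ 2 < 1.
    by rewrite -sqr_cmod expr_lt1 ?cmod_ge0.
  have -> : complex.Re (- s / (z - s)) =
      (1 - complex.Re s * complex.Re z - complex.Im s * complex.Im z) / cmod (z - s) ^+ 2.
    rewrite cReM cReV -s2; move: zs0; rewrite !sqr_cmod.
    by case: (z) (s) => a b [a' b'] /= zs0; field; rewrite gt_eqF.
  rewrite ltr_pdivlMr// sqr_cmod !cReD !cImD !cReN !cImN; lra.
- move=> z z0.
  have z20 : 0 < cmod (z + (2^-1)%:C).
    rewrite cmod_gt0; apply/eqP => /(congr1 (@complex.Re R)); rewrite cReD /=; lra.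
  have -> : s + - s / (z + (2^-1)%:C) = s * ((z - (2^-1)%:C) / (z + (2^-1)%:C)).
    have : (2^-1)%:C + (2^-1)%:C = 1 :> R[i] by rewrite -rmorphD/= -[2^-1]div1r -splitr.
    move=> h2; rewrite mulNr -{1}[s](mulfK (x := z + (2^-1)%:C)) -?cmod_gt0//.
    rewrite -mulrBl -{2}[s]mulr1 -mulrBr -mulrA; congr (_ * (_ / _)).
    by rewrite -h2; ring.
  rewrite cmodM s1 mul1r cmodM cmodV ltr_pdivrMr// mul1r.
  have := @cmodB_lt_cmodDJ _ z (2^-1)%:C z0.
  by rewrite /= oppr0; apply; rewrite invr_gt0.
- move=> x x1; have x20 : 0 < x + 2^-1 by lra.
  have -> : s + - s / (x + 2^-1)%:C = s * (1 - (x + 2^-1)^-1)%:C.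
    by rewrite rmorphB/= fmorphV mulNr mulrBr mulr1.
  have h1 : (x + 2^-1)^-1 <= 1 by rewrite invf_le1//; lra.
  by rewrite cmodM s1 mul1r cmodR ger0_norm ?subr_ge0//; lra.
- move=> z z1; have := cmodB_ge s z; rewrite s1 cmodBC; exact.
Qed.

End Boundary.

(** * Densities of absolutely continuous functions *)

Section AbsoluteContinuity.
Variable R : realType.
Implicit Types (a b : R) (p q : R * R) (s : seq (R * R)) (m : R -> R -> R) (f : R -> R).

Definition non_overlapping p q := (p.2 <= q.1) || (q.2 <= p.1).

Definition subinterval a b p := [&& a <= p.1, p.1 <= p.2 & p.2 <= b].

Definition total_length s := \sum_(p <- s) (p.2 - p.1).

Lemma non_overlapping_sym : symmetric non_overlapping.
Proof. by move=> p q; rewrite /non_overlapping orbC. Qed.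

Lemma non_overlappingW p q p' : subinterval q.1 q.2 p' -> non_overlapping q p ->
  non_overlapping p' p.
Proof.
move=> /and3P[h1 _ h2] /orP[h|h]; apply/orP.
  by left; exact: le_trans h.
by right; exact: le_trans h1.
Qed.

Lemma subinterval_trans a b q p :
  subinterval a b q -> subinterval q.1 q.2 p -> subinterval a b p.
Proof.
move=> /and3P[aq _ qb] /and3P[qp p12 pq]; rewrite /subinterval (le_trans aq qp) p12.
exact: le_trans pq qb.
Qed.

(* [m u v] stands for the variation over [u, v]; families of intervals are
   lists, so that refining some of their members is concatenation. *)
Definition ac_list a b m := forall e : R, 0 < e -> exists2 d : R, 0 < d &
  forall s, all (subinterval a b) s -> pairwise non_overlapping s ->
    total_length s < d -> \sum_(p <- s) m p.1 p.2 < e.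

Lemma abs_continuous_ac_list a b (g : R -> R[i]) : abs_continuous a b g ->
  ac_list a b (fun u v => cmod (g v - g u)).
Proof.
move=> H e /H[d d0 dH]; exists d => // s sab sp sd.
have := dH (size s) (fun i => (nth (0, 0) s i).1) (fun i => (nth (0, 0) s i).2).
rewrite /total_length !(big_nth (0, 0)) !big_mkord in sd *; apply => //.
  by move=> i; have /(all_nthP (0, 0))/(_ i (ltn_ord i))/and3P[] := sab.
apply/trivIsetP => i j _ _ ij.
have H' (k l : 'I_(size s)) : (k < l)%N ->
    `](nth (0, 0) s k).1, (nth (0, 0) s k).2[%classic `&`
    `](nth (0, 0) s l).1, (nth (0, 0) s l).2[%classic = set0.
  move=> kl; apply/seteqP; split => // x /= [].
  rewrite !in_itv/= => /andP[x1 x2] /andP[x3 x4].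
  have /(pairwiseP (0, 0))/(_ k l) := sp; rewrite !inE !ltn_ord => /(_ isT isT kl).
  by move=> /orP[h|h]; lra.
have [/H'//|ji|/val_inj/eqP] := ltngtP i j; last by rewrite (negbTE ij).
by rewrite setIC; exact: H'.
Qed.

Lemma ac_listW a b m m' (L : R) : 0 <= L ->
  (forall u v, a <= u -> u <= v -> v <= b -> m' u v <= L * m u v) ->
  ac_list a b m -> ac_list a b m'.
Proof.
move=> L0 mm' H e e0; have L1 : 0 < L + 1 by rewrite ltr_wpDl.
have [|d d0 dH] := H (e / (L + 1)); first by rewrite divr_gt0.
exists d => // s sab sp /(dH _ sab sp).
rewrite ltr_pdivlMr// mulrC mulrDl mul1r => se.
have : \sum_(p <- s) m' p.1 p.2 <= L * \sum_(p <- s) m p.1 p.2.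
  rewrite mulr_sumr big_seq [leRHS]big_seq; apply: ler_sum => p ps.
  by have /allP/(_ p ps)/and3P[? ? ?] := sab; exact: mm'.
have [M0|M0] := leP 0 (\sum_(p <- s) m p.1 p.2); first by lra.
have : L * \sum_(p <- s) m p.1 p.2 <= 0 by rewrite mulr_ge0_le0// ltW.
lra.
Qed.

Lemma ac_listD a b m m' : ac_list a b m -> ac_list a b m' ->
  ac_list a b (fun u v => m u v + m' u v).
Proof.
move=> H H' e e0; have e20 : 0 < e / 2 by rewrite divr_gt0.
have [d d0 dH] := H _ e20; have [d' d'0 d'H] := H' _ e20.
exists (Num.min d d'); first by rewrite lt_min d0.
move=> s sab sp; rewrite lt_min => /andP[sd sd']; rewrite big_split /=.
by have := dH _ sab sp sd; have := d'H _ sab sp sd'; lra.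
Qed.

Definition partition_pieces a (t : seq R) := zip (a :: t) t.

Lemma partition_piecesP a t : path <%R a t ->
  [/\ all (subinterval a (last a t)) (partition_pieces a t),
      pairwise non_overlapping (partition_pieces a t) &
      total_length (partition_pieces a t) = last a t - a].
Proof.
rewrite /total_length; elim: t a => [|x t IH] a /=.
  by rewrite big_nil subrr.
move=> /andP[ax xt]; have [al pw tl] := IH _ xt.
have xl : x <= last x t.
  move: al; case: (t) xt => [//|y t'] /= /andP[xy _] /andP[/and3P[_ _ xl] _].
  by rewrite (le_trans _ xl)// ltW.
have sub p : subinterval x (last x t) p -> subinterval a (last x t) p.
  by apply: (@subinterval_trans _ _ (x, last x t)); rewrite /subinterval /= ltW ?xl //=.
split.
- by rewrite /subinterval /= lexx ltW//= xl; apply: sub_all al.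
- rewrite pw andbT; apply: sub_all al => p /and3P[xp _ _].
  by rewrite /non_overlapping /= xp.
- by rewrite big_cons /= tl; lra.
Qed.

Lemma variation_pieces a b f t : itv_partition a b t ->
  variation a b f t = \sum_(p <- partition_pieces a t) `|f p.2 - f p.1|.
Proof.
move=> /variation_zip ->; rewrite /partition_pieces.
elim: t a => [|x t IH] a; first by rewrite !big_nil.
by rewrite /= !big_cons IH.
Qed.

Local Notation TV := (@total_variation R).

(** Intervals in [s] still carry their total variation, those in [s'] only an increment. The
    induction replaces the head of [s] by the pieces of an arbitrary partition, moved into [s'] at
    equal total length, and then takes the supremum. *)
Lemma ac_list_total_variation_sum a b f (e d : R) :
  (forall s, all (subinterval a b) s -> pairwise non_overlapping s ->
    total_length s < d -> \sum_(p <- s) `|f p.2 - f p.1| < e) ->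
  forall s s', all (subinterval a b) (s ++ s') ->
    pairwise non_overlapping (s ++ s') -> total_length (s ++ s') < d ->
    (\sum_(p <- s) TV p.1 p.2 f + (\sum_(p <- s') `|f p.2 - f p.1|)%:E <= e%:E)%E.
Proof.
move=> H; elim => [|q s IH] s' /=.
  by move=> sab sp sd; rewrite big_nil add0e lee_fin ltW// H.
move=> /andP[qab sab] /andP[qs sp]; have lenE : total_length (q :: s ++ s') = q.2 - q.1 + total_length (s ++ s').
  by rewrite /total_length big_cons.
rewrite lenE => sd.
have /and3P[aq q12 qb] := qab.
have sd0 : total_length (s ++ s') < d by lra.
have IHs := IH s' sab sp sd0.
(* The induction hypothesis makes [rest] finite, so it can be moved to the other side before taking
   the supremum. *)
set rest := (_ + _)%E in IHs.
have rest0 : (0 <= rest)%E.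
  rewrite /rest adde_ge0//; last by rewrite lee_fin sumr_ge0.
  rewrite big_seq; apply: sume_ge0 => p ps; apply: total_variation_ge0.
  have /allP/(_ p) := sab; rewrite mem_cat ps => /(_ isT)/and3P[_ + _]; exact.
have restfin : rest \is a fin_num.
  by rewrite ge0_fin_numE// (le_lt_trans IHs)// ltry.
rewrite big_cons -addeA -/rest -leeBrDr//.
apply: ge_ereal_sup => _ [x [t pt <-] <-]; rewrite leeBrDr//.
have [pt1 /eqP pt2] := pt.
have [] := partition_piecesP pt1; rewrite pt2; set P := partition_pieces _ _.
move=> Pall Ppw Plen.
rewrite (variation_pieces f pt) -/P.
have PW p : p \in P -> subinterval q.1 q.2 p by move/allP : Pall; exact.
have := IH (P ++ s').
rewrite big_cat/= EFinD addeCA; apply.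
- move: sab; rewrite !all_cat => /andP[-> ->]; rewrite /= andbT.
  by apply/allP => p /PW; exact: subinterval_trans.
- move: sp qs; rewrite !pairwise_cat allrel_catr all_cat Ppw.
  move=> /and3P[-> -> ->] /andP[qs qs'] /=; rewrite !andbT.
  apply/andP; split; apply/allrelP => p1 p2.
    move=> p1s /PW/non_overlappingW; rewrite non_overlapping_sym; apply.
    by move/allP : qs; exact.
  move=> /PW/non_overlappingW + p2s; apply.
  by move/allP : qs'; exact.
- by move: sd; rewrite -Plen /total_length !big_cat /= addrCA.
Qed.

Lemma ac_list_total_variation a b f : ac_list a b (fun u v => `|f v - f u|) ->
  (forall u v, a <= u -> u <= v -> v <= b -> TV u v f \is a fin_num) /\
  ac_list a b (fun u v => fine (TV u v f)).
Proof.
move=> H.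
have fin u v : a <= u -> u <= v -> v <= b -> TV u v f \is a fin_num.
  (* Intervals shorter than [d] have total variation at most 1; finitely many steps of length
     [d / 2] reach any other. *)
  have [d d0 dH] := H 1 ltr01.
  have loc x y : a <= x -> x <= y -> y <= b -> y - x < d -> (TV x y f < +oo)%E.
    move=> ax xy yb xyd.
    have := @ac_list_total_variation_sum a b f 1 d dH [:: (x, y)] [::].
    rewrite /= /subinterval /= ax xy yb /total_length big_seq1 => /(_ isT isT xyd).
    rewrite big_seq1 big_nil adde0 /= => /le_lt_trans; apply; exact: ltry.
  move=> au uv vb; rewrite ge0_fin_numE; last exact: total_variation_ge0.
  have d20 : 0 < d / 2 by rewrite divr_gt0.
  have main n : forall y, u <= y -> y <= b -> y - u <= n%:R * (d / 2) -> (TV u y f < +oo)%E.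
    elim: n => [|n IH] y uy yb; rewrite ?mul0r => yn.
      have -> : y = u by lra.
      by rewrite total_variationxx ltry.
    have [yd|yd] := leP (y - u) (d / 2); first by apply: loc => //; lra.
    rewrite (@total_variationD _ _ _ (y - d / 2)); [|lra|lra].
    rewrite lte_add_pinfty//; last by apply: loc; lra.
    apply: IH; [lra|lra|]; move: yn; rewrite -natr1 mulrDl mul1r; lra.
  apply: (main (Num.bound ((v - u) / (d / 2)))) => //.
  rewrite -ler_pdivrMr// ltW// archi_boundP// divr_ge0 ?subr_ge0// ltW//.
split => // e e0; have e20 : 0 < e / 2 by rewrite divr_gt0.
have [d d0 dH] := H _ e20; exists d => // s sab sp sd.
have := @ac_list_total_variation_sum a b f (e / 2) d dH s [::].
rewrite cats0 => /(_ sab sp sd); rewrite big_nil adde0.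
have -> : (\sum_(p <- s) TV p.1 p.2 f = (\sum_(p <- s) fine (TV p.1 p.2 f))%:E)%E.
  rewrite -sumEFin big_seq [RHS]big_seq; apply: eq_bigr => p ps.
  by have /allP/(_ p ps)/and3P[? ? ?] := sab; rewrite fineK// fin.
rewrite lee_fin; lra.
Qed.

End AbsoluteContinuity.

(** * Inner approximation of open sets by finitely many dyadic intervals *)

Section DyadicCover.
Variables (R : realType) (U : set R).
Implicit Types (x y t : R) (s : seq (R * R)).
Local Notation lambda := (@lebesgue_measure R).

(* The maximal intervals inside [U] among the halvings of ]x, y] of depth <= n. *)
Fixpoint dyadic_pieces (n : nat) x y : seq (R * R) :=
  if `[< `]x, y]%classic `<=` U >] then [:: (x, y)] else
  if n is n'.+1 then
    dyadic_pieces n' x ((x + y) / 2) ++ dyadic_pieces n' ((x + y) / 2) y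
  else [::].

(** Half-open intervals let the two halves tile the whole, and their Stieltjes measure is directly
    an increment. *)
Definition covered s : set R := [set t | has (fun p => p.1 < t <= p.2) s].

Lemma dyadic_piecesP n x y : x <= y ->
  all (subinterval x y) (dyadic_pieces n x y) /\
  pairwise (@non_overlapping R) (dyadic_pieces n x y).
Proof.
elim: n x y => [|n IH] x y xy /=; case: asboolP => _ //=;
  rewrite /subinterval /= ?lexx ?xy//.
set m := (x + y) / 2.
have xm : x <= m by rewrite /m; lra.
have my : m <= y by rewrite /m; lra.
have [a1 p1] := IH x m xm; have [a2 p2] := IH m y my.
rewrite all_cat pairwise_cat p1 p2 andbT; split.
  apply/andP; split; [apply: sub_all a1|apply: sub_all a2] => p.
    by apply: (@subinterval_trans _ _ _ (x, m)); rewrite /subinterval /= lexx xm.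
  by apply: (@subinterval_trans _ _ _ (m, y)); rewrite /subinterval /= xm my lexx.
rewrite andbT; apply/allrelP => p q /(allP a1)/and3P[_ _ pm] /(allP a2)/and3P[mq _ _].
by apply/orP; left; exact: le_trans mq.
Qed.

Lemma covered_cat s s' : covered (s ++ s') = covered s `|` covered s'.
Proof.
by apply/seteqP; split => t; rewrite /covered /= has_cat => /orP.
Qed.

Lemma covered1 x y : covered [:: (x, y)] = `]x, y]%classic.
Proof. by apply/seteqP; split => t; rewrite /covered /= orbF in_itv. Qed.

Lemma covered_nondecreasing x y :
  {homo (fun n => covered (dyadic_pieces n x y)) : n m / (n <= m)%N >-> n `<=` m}.
Proof.
suff H n : forall x y, covered (dyadic_pieces n x y) `<=` covered (dyadic_pieces n.+1 x y).
  apply: homo_leq; [by move=> A t|by move=> B A D; exact: subset_trans|by move=> k; exact: H].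
have E k x' y' : dyadic_pieces k.+1 x' y' = if `[< `]x', y']%classic `<=` U >] then
    [:: (x', y')] else dyadic_pieces k x' ((x' + y') / 2) ++ dyadic_pieces k ((x' + y') / 2) y'.
  by [].
elim: n => [|n IH] x' y'; rewrite ![in X in _ `<=` X]E.
  by rewrite /=; case: asboolP => // _ t.
rewrite E; case: asboolP => _; first exact: subset_refl.
by rewrite 2!covered_cat; apply: setUSS; exact: IH.
Qed.

(** After enough halvings the interval containing [t] is shorter than [r], so it lies in [U], unless
    a larger one was kept earlier. *)
Lemma covered_exhaustive x y t (r : R) : 0 < r ->
  (forall t', `|t' - t| < r -> U t') -> x < t <= y ->
  exists n, covered (dyadic_pieces n x y) t.
Proof.
move=> r0 rU txy.
exists (Num.bound ((y - x) / r)).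
have : y - x < r * 2 ^+ Num.bound ((y - x) / r).
  rewrite mulrC -ltr_pdivrMr// (@lt_trans _ _ (Num.bound ((y - x) / r))%:R)//.
    rewrite archi_boundP// divr_ge0 ?(ltW r0)// subr_ge0; move: txy => /andP[? ?]; lra.
  by rewrite -natrX ltr_nat ltn_expl.
move: (Num.bound ((y - x) / r)) => N.
elim: N x y txy => [|n IH] x y txy; rewrite ?expr0 ?mulr1 => yx /=.
  case: asboolP => [_|[]]; first by rewrite covered1 /= in_itv.
  move=> t'; rewrite /= in_itv/= => t'xy; apply: rU.
  by move: txy t'xy => /andP[? ?] /andP[? ?]; rewrite ltr_norml; apply/andP; split; lra.
case: asboolP => _; first by rewrite covered1 /= in_itv.
move: yx; rewrite exprS mulrCA => yx; move: txy => /andP[xt ty].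
rewrite covered_cat; have [tm|mt] := leP t ((x + y) / 2); [left|right]; apply: IH.
- by rewrite xt.
- lra.
- by rewrite mt.
- lra.
Qed.

Lemma measurable_covered s : measurable (covered s).
Proof.
elim: s => [|[x y] s IH].
  rewrite (_ : covered [::] = set0)//; by apply/seteqP; split.
rewrite -cat1s covered_cat covered1; apply: measurableU => //.
Qed.

Lemma measure_covered (nu : {measure set (measurableTypeR R) -> \bar R}) (F : R -> R -> R) s :
  (forall p, p \in s -> (nu `]p.1, p.2]%classic <= (F p.1 p.2)%:E)%E) ->
  (nu (covered s) <= (\sum_(p <- s) F p.1 p.2)%:E)%E.
Proof.
elim: s => [|[x y] s IH] H.
  rewrite big_nil (_ : covered [::] = set0) ?measure0//; by apply/seteqP; split.
rewrite big_cons -cat1s covered_cat covered1 EFinD.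
apply: le_trans (measureU2 _ _ _) _ => //; first exact: measurable_covered.
apply: leeD; first by apply: (H (x, y)); rewrite mem_head.
by apply: IH => p ps; apply: H; rewrite in_cons ps orbT.
Qed.

Lemma total_length_dyadic_pieces n x y : measurable U -> x <= y ->
  ((total_length (dyadic_pieces n x y))%:E <= lambda (U `&` `]x, y]%classic))%E.
Proof.
move=> mU.
have base x' y' : x' <= y' -> `]x', y']%classic `<=` U ->
    ((total_length [:: (x', y')])%:E <= lambda (U `&` `]x', y']%classic))%E.
  move=> xy' xyU; rewrite (setIidr xyU) /total_length big_seq1 /= lebesgue_measure_itv /= lte_fin.
  by case: ltgtP xy' => //= -> _; rewrite subrr.
elim: n x y => [|n IH] x y xy /=; case: asboolP => [xyU|_]; do ?[exact: base].
  by rewrite /total_length big_nil measure_ge0.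
set m := (x + y) / 2.
have xm : x <= m by rewrite /m; lra.
have my : m <= y by rewrite /m; lra.
rewrite /total_length big_cat /= EFinD.
rewrite (@itv_bndbnd_setU _ _ _ (BRight m)) ?bnd_simp// setIUr measureU//.
- by apply: leeD; exact: IH.
- by apply: measurableI.
- by apply: measurableI.
- apply/seteqP; split => // t [[_ /=]]; rewrite in_itv/= => /andP[_ tm] [_ /=].
  by rewrite in_itv/= ltNge tm.
Qed.

End DyadicCover.

(** * Stieltjes measures of absolutely continuous monotone functions *)

Section MonotoneDensity.
Variable R : realType.
Local Notation lambda := (@lebesgue_measure R).
Implicit Types (a b t u x y : R) (F : R -> R).

Definition clamp a b t := Num.max a (Num.min b t).

Lemma clamp_ge a b t : a <= clamp a b t.
Proof. by rewrite le_max lexx. Qed.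

Lemma clamp_le a b t : a <= b -> clamp a b t <= b.
Proof. by move=> ab; rewrite ge_max ab ge_min lexx. Qed.

Lemma clamp_id a b t : a <= t -> t <= b -> clamp a b t = t.
Proof. by move=> at_ tb; rewrite /clamp min_r// max_r. Qed.

Lemma clamp_nondecreasing a b : {homo clamp a b : t u / t <= u}.
Proof. move=> t u tu; rewrite /clamp !maxEle !minEle.
by do ![case: ifPn]; rewrite -?ltNge => *; lra. Qed.

Lemma clamp_dist a b t u : t <= u -> clamp a b u - clamp a b t <= u - t.
Proof.
move=> tu; rewrite /clamp !maxEle !minEle.
by do ![case: ifPn]; rewrite -?ltNge => *; lra.
Qed.

Section LebesgueStieltjes.
Variables (F : R -> R) (a b : R).
Hypotheses (ab : a <= b)
  (ndF : forall u v, a <= u -> u <= v -> v <= b -> F u <= F v)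
  (acF : ac_list a b (fun u v => F v - F u)).

(** [F] is controlled on [[a, b]] only; freezing it outside yields a continuous nondecreasing
    function on the line, as a Stieltjes measure requires. *)
Let G t := F (clamp a b t).

Let ndG : nondecreasing G.
Proof.
move=> t u tu; apply: ndF; first exact: clamp_ge.
  exact: clamp_nondecreasing.
exact: clamp_le.
Qed.

Let contG : continuous G.
Proof.
move=> x; apply: continuous_epsdelta => e /acF[d d0 dH].
have main u v : u <= v -> v - u < d -> G v - G u < e.
  move=> uv uvd; have := dH [:: (clamp a b u, clamp a b v)].
  rewrite /total_length !big_seq1 /=; apply => //.
    by rewrite /subinterval /= clamp_ge clamp_le// clamp_nondecreasing.
  by apply: le_lt_trans uvd; exact: clamp_dist.
exists d => // y yx; have [xy|/ltW xy] := leP x y.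
  rewrite ger0_norm ?subr_ge0 ?ndG//; apply: main => //.
  by rewrite -[ltLHS]ger0_norm// subr_ge0.
rewrite distrC ger0_norm ?subr_ge0 ?ndG//; apply: main => //.
by rewrite -[ltLHS]ger0_norm ?subr_ge0// distrC.
Qed.

Let rcG : forall x, G @ at_right x --> G x.
Proof. by apply: right_continuousW; exact: contG. Qed.

Let cumG : cumulative R R := HB.pack G (isCumulative.Build R _ R G ndG rcG).

Let nu := lebesgue_stieltjes_measure cumG.

Let nu_itv x y : x <= y -> nu `]x, y]%classic = (G y - G x)%:E.
Proof.
move=> xy; rewrite /nu /lebesgue_stieltjes_measure /measure_extension.
rewrite measurable_mu_extE//; last exact: is_ocitv.
exact: (wlength_itv_bnd G _ _ xy).
Qed.

Let nu_fin : (nu `]a, b]%classic < +oo)%E.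
Proof. by rewrite nu_itv// ltry. Qed.

Let mab : measurable (`]a, b]%classic : set (measurableTypeR R)).
Proof. exact: measurable_itv. Qed.

Let nuab : {finite_measure set (measurableTypeR R) -> \bar R} := mfrestr mab nu_fin.

(** A null set has an open neighbourhood [U] of measure below [d]. Absolute continuity handles
    finitely many intervals at a time, so it bounds the dyadic pieces of [U] at each depth by [e];
    continuity from below passes to their union, which covers the part of the null set in []a,
    b]]. *)
Let nuab_null : nuab `<< lambda.
Proof.
apply/null_content_dominatesP => N mN N0.
apply/eqP; rewrite eq_le measure_ge0 andbT.
apply/lee_addgt0Pr => e e0; rewrite add0e.
have [d d0 dH] := acF e0.
have [|U [oU NU UN]] := lebesgue_regularity_outer mN _ d0; first by rewrite N0 ltry.
have mU : measurable U by exact: measurable_realfun.open_measurable.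
have Ud : (lambda U < d%:E)%E.
  rewrite -(setDUK NU); apply: le_lt_trans (measureU2 _ _ _) _ => //.
    exact: measurableD.
  by rewrite N0 add0e.
pose P n := covered (dyadic_pieces U n a b).
have Pe n : (nu (P n) <= e%:E)%E.
  have [Pall Ppw] := dyadic_piecesP U n ab.
  apply: (@le_trans _ _ (\sum_(p <- dyadic_pieces U n a b) (F p.2 - F p.1))%:E).
    apply: (@measure_covered R (lebesgue_stieltjes_measure cumG) (fun x y => F y - F x)) => p /(allP Pall)/and3P[ap p12 pb].
    apply: (@le_trans _ _ (G p.2 - G p.1)%:E); first by rewrite -nu_itv.
    by rewrite /G !clamp_id// ?(le_trans p12)// (le_trans ap).
  rewrite lee_fin ltW//; apply: dH => //.
  by rewrite -lte_fin; apply: le_lt_trans Ud; apply: le_trans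
    (total_length_dyadic_pieces n mU ab) _; apply: le_measure; rewrite ?inE//; exact: measurableI.
have cvgP : (nu \o P) n @[n --> \oo] --> nu (\bigcup_n P n).
  apply: nondecreasing_cvg_mu.
  - by move=> n; exact: measurable_covered.
  - by apply: bigcup_measurable => n _; exact: measurable_covered.
  - by move=> m n mn; apply/subsetPset; exact: covered_nondecreasing.
have Ple : (nu (\bigcup_n P n) <= e%:E)%E.
  rewrite -(cvg_lim _ cvgP)//; apply: lime_le; last exact: nearW.
  by apply/cvg_ex; eexists; exact: cvgP.
apply: le_trans Ple; apply: le_measure; rewrite ?inE.
- exact: measurableI.
- by apply: bigcup_measurable => n _; exact: measurable_covered.
move=> t [Nt]; rewrite /= in_itv/= => tab.
have /nbhs_ballP[r /= r0 rU] : nbhs t U by apply: open_nbhs_nbhs; split => //; exact: NU.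
have [|n Pn] := @covered_exhaustive _ U a b t r r0 _ tab; last by exists n.
by move=> t' tt'; apply: rU; rewrite -ball_normE /= distrC.
Qed.

(** The last clause confines the density to []a, b]], so that densities of successive intervals can
    be added without affecting one another. *)
Lemma monotone_density : exists f : R -> \bar R,
  [/\ forall x, (0 <= f x)%E, lambda.-integrable setT f,
      forall t u, a <= t -> t <= u -> u <= b ->
        ((F u - F t)%:E <= \int[lambda]_(x in `[t, u]) f x)%E &
      forall A, measurable A -> A `&` `]a, b]%classic = set0 ->
        (\int[lambda]_(x in A) f x = 0)%E].
Proof.
have [f [f0 _ fint fE]] := radon_nikodym_sigma_finite nuab_null.
exists f; split => //.
  move=> t u at_ tu ub; rewrite -fE; last exact: measurable_itv.
  rewrite -[F u](@congr1 _ _ F _ _ (clamp_id (le_trans at_ tu) ub)).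
  rewrite -[F t](@congr1 _ _ F _ _ (clamp_id at_ (le_trans tu ub))) -[X in (X <= _)%E]nu_itv//.
  apply: le_measure; rewrite ?inE.
  - exact: measurable_itv.
  - by apply: measurableI => //; exact: measurable_itv.
  move=> x; rewrite /= !in_itv/= => /andP[tx xu]; rewrite (ltW tx) xu (le_lt_trans at_ tx).
  by rewrite (le_trans xu ub).
move=> A mA A0; rewrite -fE//.
change (nu (A `&` `]a, b]%classic) = 0)%E; rewrite A0.
exact: measure0.
Qed.

End LebesgueStieltjes.
End MonotoneDensity.

(** * Gluing the densities over the time interval *)

Section LocalDensity.
Variable R : realType.
Local Notation lambda := (@lebesgue_measure R).
Implicit Types (a b t u x y : R) (I : set R) (F : R -> R).

Lemma time_interval_exhaustion I : time_interval I ->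
  [/\ measurable I,
      forall t u, I u -> 0 <= t -> t <= u -> I t,
      forall r, I r -> 0 <= r &
      exists beta : nat -> R, [/\ beta 0%N = 0, forall n, beta n <= beta n.+1,
        forall n, I (beta n) & forall r, I r -> exists n, r <= beta n]].
Proof.
move=> [[T T0 ->]|[T T0 ->]|->]; (split; first exact: measurable_itv).
- by move=> t u /=; rewrite !in_itv/= => /andP[_ uT] -> /= /le_trans; exact.
- by move=> r /=; rewrite in_itv/= => /andP[].
- exists (fun n => if n is 0 then 0 else T); split => //.
  + by move=> [|n] //; exact: ltW.
  + by move=> [|n] /=; rewrite in_itv/= lexx ?(ltW T0).
  + by move=> r /=; rewrite in_itv/= => /andP[_ rT]; exists 1%N.
- by move=> t u /=; rewrite !in_itv/= => /andP[_ uT] -> /= /le_lt_trans; exact.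
- by move=> r /=; rewrite in_itv/= => /andP[].
- have n1 n : 0 < n.+1%:R :> R by rewrite ltr0n.
  (* The index [n.+1] makes the sequence start at exactly 0 and stay below [T]. *)
  exists (fun n => T - T / n.+1%:R); split.
  + by rewrite divr1 subrr.
  + move=> n; rewrite lerD2l lerN2 ler_pM2l// lef_pV2 ?posrE ?n1// ler_nat//.
  + move=> n /=; rewrite in_itv/= subr_ge0 ltrBlDr ltrDl divr_gt0// andbT.
    by rewrite ler_pdivrMr// ler_peMr ?ler1n// ltW.
  + move=> r /=; rewrite in_itv/= => /andP[_ rT].
    have Tr : 0 < T - r by rewrite subr_gt0.
    exists (Num.bound (T / (T - r))).
    rewrite lerBrDr -lerBrDl ler_pdivrMr// mulrC -ler_pdivrMr//.
    apply: ltW; apply: lt_trans (archi_boundP _) _; first by rewrite divr_ge0// ltW.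
    by rewrite ltr_nat.
- by move=> t u /=; rewrite !in_itv/= !andbT.
- by move=> r /=; rewrite in_itv/= andbT.
- exists (fun n => n%:R); split => //.
  + by move=> n; rewrite ler_nat.
  + by move=> n /=; rewrite in_itv/= ler0n.
  + move=> r /=; rewrite in_itv/= andbT => r0; exists (Num.bound r).
    exact/ltW/archi_boundP.
Qed.

Lemma ac_list_sub a b a' b' (m : R -> R -> R) : a <= a' -> b' <= b ->
  ac_list a b m -> ac_list a' b' m.
Proof.
move=> aa bb H e /H[d d0 dH]; exists d => // s /allP sab; apply: dH.
apply/allP => p /sab/and3P[ap pp pb]; apply/and3P; split => //.
  exact: le_trans ap.
exact: le_trans bb.
Qed.

Lemma le_fine_ereal (s : \bar R) : (0 <= s)%E -> ((fine s)%:E <= s)%E.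
Proof. by case: s => [r||] //=; rewrite leey. Qed.

Lemma locally_ac_density I F : time_interval I ->
  (forall u v, I u -> I v -> u <= v -> F u <= F v) ->
  (forall b, I b -> ac_list 0 b (fun u v => F v - F u)) ->
  exists f : R -> R, [/\ L1_loc I f, forall r, I r -> 0 <= f r &
    forall t u, I t -> I u -> t <= u ->
      ((F u - F t)%:E <= \int[lambda]_(r in `[t, u]) (f r)%:E)%E].
Proof.
move=> hI ndF acF.
have [mI Idown I0 [beta [b0 bS bI Ib]]] := time_interval_exhaustion hI.
have bm : {homo beta : m n / (m <= n)%N >-> m <= n}.
  by apply: homo_leq => //; exact: le_trans.
have b_ge0 n : 0 <= beta n by exact/I0/bI.
have Iin n t : 0 <= t -> t <= beta n -> I t by move=> t0 /Idown; exact.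
have /choice[f_ fP] n : exists f : R -> \bar R,
  [/\ forall x, (0 <= f x)%E, lambda.-integrable setT f,
      forall t u, beta n <= t -> t <= u -> u <= beta n.+1 ->
        ((F u - F t)%:E <= \int[lambda]_(x in `[t, u]) f x)%E &
      forall A, measurable A -> A `&` `]beta n, beta n.+1]%classic = set0 ->
        (\int[lambda]_(x in A) f x = 0)%E].
  apply: monotone_density; first exact: bS.
    move=> u v bu uv vb; apply: ndF => //.
      by apply: (Iin n.+1); rewrite ?(le_trans uv)// (le_trans _ bu).
    by apply: (Iin n.+1) => //; rewrite (le_trans _ uv)// (le_trans _ bu).
  exact: ac_list_sub (acF _ (bI n.+1)).
have f0 n x : (0 <= f_ n x)%E by have [] := fP n.
have mf n (D : set (measurableTypeR R)) : measurable D ->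
    @measurable_fun _ _ (measurableTypeR R) (\bar R) D (f_ n).
  move=> mD; have [_ /measurable_int + _ _] := fP n.
  exact: measurable_funTS.
have i0 n D : (0 <= \int[lambda]_(x in D) f_ n x)%E by apply: integral_ge0.
have sub n t u t' u' : t' <= t -> u <= u' ->
    (\int[lambda]_(x in `[t, u]) f_ n x <= \int[lambda]_(x in `[t', u']) f_ n x)%E.
  move=> tt uu; apply: ge0_subset_integral => //.
    by apply: mf.
  by apply: subset_itv; rewrite bnd_simp.
(* An interval ending before [beta N] only needs the first [N] densities; one straddling [beta N] is
   cut there. *)
have lower N : forall t u, 0 <= t -> t <= u -> u <= beta N ->
    ((F u - F t)%:E <= \sum_(0 <= n < N) \int[lambda]_(x in `[t, u]) f_ n x)%E.
  elim: N => [|N IH] t u t0 tu ub.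
    rewrite big_geq//; move: ub; rewrite b0 => ub.
    have -> : t = u by lra.
    by rewrite subrr.
  rewrite big_nat_recr//=; have [uN|Nu] := leP u (beta N).
    by rewrite -[X in (X <= _)%E]adde0; apply: leeD; [exact: IH|exact: i0].
  have [_ _ dN _] := fP N.
  have [tN|Nt] := leP t (beta N).
    have -> : F u - F t = (F (beta N) - F t) + (F u - F (beta N)) by lra.
    rewrite EFinD; apply: leeD.
      apply: le_trans (IH _ _ t0 tN (lexx _)) _.
      by apply: lee_sum => n _; apply: sub => //; exact: ltW.
    by apply: le_trans (dN _ _ _ _ ub) _ => //; [exact: ltW|apply: sub].
  rewrite -[X in (X <= _)%E]add0e; apply: leeD; first exact: sume_ge0.
  by apply: dN => //; exact: ltW.
pose S x := (\sum_(0 <= n <oo) f_ n x)%E.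
have S0 x : (0 <= S x)%E by apply: nneseries_ge0.
have mS (D : set (measurableTypeR R)) : measurable D ->
    @measurable_fun _ _ (measurableTypeR R) (\bar R) D S.
  move=> mD; rewrite /S.
  exact: (@ge0_emeasurable_sum _ _ R D f_ xpredT (fun k x _ _ => f0 k x) (fun k _ => mf k D mD)).
have intS D : measurable D ->
    (\int[lambda]_(x in D) S x = \sum_(0 <= n <oo) \int[lambda]_(x in D) f_ n x)%E.
  by move=> mD; rewrite /S integral_nneseries// => n; exact: mf.
(* Densities of index at least [N] integrate to 0 over [[0, beta N]], which leaves a finite sum of
   finite integrals. *)
have Sfin N : (\int[lambda]_(x in `[0%R, beta N]) S x < +oo)%E.
  rewrite intS//; rewrite (nneseries_split 0 N)// add0n.
  rewrite (@eseries0 _ _ N); last first.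
    move=> n Nn _; have [_ _ _ d0] := fP n; apply: d0 => //.
    apply/seteqP; split => // x /= []; rewrite !in_itv/= => /andP[_ xN] /andP[nx _].
    by have := bm _ _ Nn; rewrite leNgt (lt_le_trans nx xN).
  rewrite adde0; apply: lte_sum_pinfty => n _.
  have [_ iT _ _] := fP n.
  have /integrableP[_] : lambda.-integrable `[0%R, beta N] (f_ n).
    exact: integrableS iT.
  by under eq_integral do rewrite gee0_abs//.
have iS a b : 0 <= a -> I b -> lambda.-integrable `[a, b] S.
  move=> a0 /Ib[N bN]; apply/integrableP; split; first exact: mS.
  under eq_integral do rewrite gee0_abs//.
  apply: le_lt_trans (Sfin N); apply: ge0_subset_integral => //; first exact: mS.
  by apply: subset_itv; rewrite bnd_simp.
(* [fine] sends infinite values to 0. On compact parts of [I] the sum is integrable, hence finite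
   almost everywhere, and its integrals do not change. *)
exists (fine \o S); split.
- split.
    by apply: measurableT_comp => //; exact: mS.
  move=> a b ab abI.
  have Ia : I a by apply: abI; rewrite /= in_itv/= lexx.
  have Ib' : I b by apply: abI; rewrite /= in_itv/= lexx ab.
  apply: (le_integrable _ _ _ (iS a b (I0 _ Ia) Ib')) => //.
    by apply/measurable_EFinP; apply: measurableT_comp => //; exact: mS.
  move=> x _; rewrite (gee0_abs (S0 x)) /= ger0_norm ?fine_ge0//.
  exact: le_fine_ereal.
- by move=> r _; rewrite /= fine_ge0.
move=> t u It Iu tu.
have [N uN] := Ib _ Iu.
apply: (@le_trans _ _ (\int[lambda]_(r in `[t, u]) S r)%E).
  rewrite intS//; apply: le_trans (lower N _ _ (I0 _ It) tu uN) _.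
  exact: nneseries_lim_ge.
rewrite le_eqVlt; apply/orP; left; apply/eqP; apply: ae_eq_integral => //.
- exact: mS.
- by apply/measurable_EFinP; apply: measurableT_comp => //; exact: mS.
have := integrable_ae _ (iS t u (I0 _ It) Iu).
move=> /(_ ltac:(by [])).
by apply: filterS => x Sx tux /=; rewrite fineK//; exact: Sx.
Qed.

End LocalDensity.

(** * Evolution families *)

Section Evolution.
Variable R : realType.
Local Notation TV := (@total_variation R).
Implicit Types (D : domain) (I : set R).

Lemma bdist_gt0 D (z : R[i]) : dom D z -> 0 < bdist D z.
Proof. by case: D => //= z1; rewrite subr_gt0. Qed.

Lemma bdist_lip D (z z' : R[i]) : `|bdist D z - bdist D z'| <= cmod (z - z').
Proof.
case: D => /=; last by rewrite -cReN -cReD ler_Re_cmod.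
have := cmodB_ge z z'; have := cmodB_ge z' z; rewrite (cmodBC z' z) => ? ?.
by rewrite ler_norml; apply/andP; split; lra.
Qed.

Lemma ac_path_bdist_min D (g : R -> R[i]) (b : R) : 0 <= b ->
  ac_list 0 b (fun u v => cmod (g v - g u)) ->
  (forall t, 0 <= t -> t <= b -> dom D (g t)) ->
  exists2 d, 0 < d & forall t, 0 <= t -> t <= b -> d <= bdist D (g t).
Proof.
move=> b0 acg gD; pose f t := bdist D (g (clamp 0 b t)).
have cf : {within `[0, b], continuous f}.
  apply: continuous_subspaceT => x; apply: continuous_epsdelta => e /acg[d d0 dH].
  have main u v : u <= v -> v - u < d -> cmod (g (clamp 0 b v) - g (clamp 0 b u)) < e.
    move=> uv uvd; have := dH [:: (clamp 0 b u, clamp 0 b v)].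
    rewrite /total_length !big_seq1 /=; apply => //.
      by rewrite /subinterval /= clamp_ge clamp_le// clamp_nondecreasing.
    by apply: le_lt_trans uvd; exact: clamp_dist.
  exists d => // y yx; apply: le_lt_trans (bdist_lip _ _ _) _.
  have [xy|/ltW xy] := leP x y.
    by apply: main => //; rewrite -[ltLHS]ger0_norm// subr_ge0.
  by rewrite cmodBC; apply: main => //; rewrite -[ltLHS]ger0_norm ?subr_ge0// distrC.
have [c _ cmin] := EVT_min b0 cf.
exists (f c); first by apply: bdist_gt0; apply: gD; [exact: clamp_ge|exact: clamp_le].
move=> t t0 tb; have := cmin t; rewrite in_itv/= t0 tb => /(_ isT).
by rewrite {2}/f clamp_id.
Qed.

(** [total_variation] concerns real functions, so [V] adds the variations of the real and imaginary
    parts; this sum dominates the modulus of every increment. *)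
Lemma ac_variation_function I (g : R -> R[i]) :
  (forall t u, I u -> 0 <= t -> t <= u -> I t) -> (forall t, I t -> 0 <= t) -> I 0 ->
  (forall b, I b -> ac_list 0 b (fun u v => cmod (g v - g u))) ->
  exists V : R -> R, [/\ V 0 = 0,
    forall u v, I u -> I v -> u <= v -> cmod (g v - g u) <= V v - V u &
    forall b, I b -> ac_list 0 b (fun u v => V v - V u)].
Proof.
move=> Idown Ige0 I0 acg.
pose gr t := complex.Re (g t); pose gi t := complex.Im (g t).
have acr b : I b -> ac_list 0 b (fun u v => `|gr v - gr u|).
  move=> Ib; apply: (ac_listW ler01 _ (acg b Ib)) => u v _ _ _.
  by rewrite mul1r -cReN -cReD ler_Re_cmod.
have aci b : I b -> ac_list 0 b (fun u v => `|gi v - gi u|).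
  move=> Ib; apply: (ac_listW ler01 _ (acg b Ib)) => u v _ _ _.
  by rewrite mul1r -cImN -cImD ler_Im_cmod.
pose V t := fine (TV 0 t gr) + fine (TV 0 t gi).
have VB b u v : I b -> 0 <= u -> u <= v -> v <= b ->
    V v - V u = fine (TV u v gr) + fine (TV u v gi).
  move=> Ib u0 uv vb.
  have [finr _] := ac_list_total_variation (acr b Ib).
  have [fini _] := ac_list_total_variation (aci b Ib).
  have ub := le_trans uv vb.
  rewrite /V !(@total_variationD _ 0 v u)// !fineD ?finr ?fini//; lra.
exists V; split.
- by rewrite /V !total_variationxx /= addr0.
- move=> u v Iu Iv uv; rewrite (VB v)//; last exact: Ige0.
  have [finr _] := ac_list_total_variation (acr v Iv).
  have [fini _] := ac_list_total_variation (aci v Iv).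
  apply: le_trans (cmod_le_ReIm _) _; rewrite cReD cImD cReN cImN.
  have u0 := Ige0 u Iu.
  apply: lerD; rewrite -lee_fin fineK ?finr ?fini//.
    exact: (total_variation_ge gr uv).
  exact: (total_variation_ge gi uv).
move=> b Ib.
have [_ tvr] := ac_list_total_variation (acr b Ib).
have [_ tvi] := ac_list_total_variation (aci b Ib).
apply: (ac_listW ler01 _ (ac_listD tvr tvi)) => u v u0 uv vb.
by rewrite mul1r (VB b).
Qed.

(** The difference [h - W] may have vanishing real part, for instance when [h = W]; this is why
    [harnack] accepts nonnegative real parts. *)
Lemma right_half_self_increment (W : R[i] -> R[i]) (h : R[i] -> R[i]) a b :
  right_half_self W -> right_half_self h ->
  (forall z, 0 < complex.Re z -> complex.Re (W z) <= complex.Re (h z)) ->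
  0 < complex.Re a -> 0 < complex.Re b ->
  cmod (h b - W b) * (complex.Re a * complex.Re b) <=
  cmod (h a - W a) * (cmod a + cmod b) ^+ 2.
Proof.
move=> rW rh Wh a0 b0; apply: (@harnack _ (fun z => h z - W z)) => //.
  by move=> z z0; rewrite cReD cReN subr_ge0; exact: Wh.
by move=> z z0; apply: holomorphic_atB; [exact: rh.2|exact: rW.2].
Qed.

End Evolution.

Theorem theorem4 (R : realType) (D : domain) (tau : sphere R)
    (htau : bdry D tau)
    (I : set R) (hI : time_interval I)
    (w : R -> R -> R[i] -> R[i])
    (hU : forall s t : R, I s -> I t -> s <= t -> frakU D tau (w s t))
    (hid : forall s : R, I s -> forall z : R[i], dom D z -> w s s z = z)
    (hcomp : forall s t u : R, I s -> I t -> I u -> s <= t -> t <= u ->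
       forall z : R[i], dom D z -> w s u z = w t u (w s t z))
    (hAC : exists2 z0 : R[i], dom D z0 & AC_loc I (fun t => w 0 t z0)) :
  AC_evolution_family D I w.
Proof.
have Hw s t : I s -> I t -> s <= t -> Hol D (w s t).
  by move=> Is It st; exact: frakU_Hol (hU _ _ Is It st).
split; [exact: Hw|by split|].
have [_ Idown Ige0 [beta [beta0 _ betaI _]]] := time_interval_exhaustion hI.
have I0 : I 0 by rewrite -beta0.
have [T [S [TS ST rhs Slip Tlip]]] := chart_exists htau.
case: hAC => z0 z0D acw.
have wD s t z : I s -> I t -> s <= t -> dom D z -> dom D (w s t z).
  by move=> Is It st; have [+ _] := Hw _ _ Is It st; exact.
have acT b : I b -> ac_list 0 b (fun u v => cmod (T (w 0 v z0) - T (w 0 u z0))).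
  move=> Ib; have b0 := Ige0 _ Ib.
  have inI t : 0 <= t -> t <= b -> I t by exact: Idown.
  have /abs_continuous_ac_list acg : abs_continuous 0 b (fun t => w 0 t z0).
    apply: acw => // t; rewrite /= in_itv/= => /andP[t0 tb]; exact: inI.
  have gD t : 0 <= t -> t <= b -> dom D (w 0 t z0).
    by move=> t0 tb; apply: wD => //; exact: inI.
  have [d d0 dmin] := ac_path_bdist_min b0 acg gD.
  have [L L0 HL] := Tlip d d0.
  apply: (ac_listW L0 _ acg) => u v u0 uv vb.
  have v0 := le_trans u0 uv; have ub := le_trans uv vb.
  by apply: HL; [exact: gD|exact: gD|exact: dmin|exact: dmin].
have [V [V0 dV acV]] := ac_variation_function Idown Ige0 I0 acT.
have Vmono u v : I u -> I v -> u <= v -> V u <= V v.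
  by move=> Iu Iv uv; rewrite -subr_ge0; apply: le_trans (dV _ _ Iu Iv uv); exact: cmod_ge0.
have V_ge0 t : I t -> 0 <= V t.
  by move=> It; rewrite -V0; apply: Vmono => //; exact: Ige0.
move=> z zD.
have [Tz STz] := TS z zD; have [Tz0 STz0] := TS z0 z0D.
(* By Julia's inequality all images of [T z] have real part at least [Re (T z)], so one Lipschitz
   constant of [S] serves all times. *)
have [L L0 HL] := Slip _ Tz.
pose A := cmod (T z) + cmod (T z0).
pose C := L / (complex.Re (T z0) * complex.Re (T z)).
have A0 : 0 <= A by rewrite addr_ge0 ?cmod_ge0.
have C0 : 0 <= C by rewrite divr_ge0// mulr_ge0// ltW.
(* Phi v - Phi u dominates C (A + V u)^2 (V v - V u), the Harnack bound. *)
pose Phi t := C * (A + V t) ^+ 3.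
have cubeB p q : p ^+ 3 - q ^+ 3 = (p - q) * (p ^+ 2 + p * q + q ^+ 2) :> R by ring.
have PhiB u v : Phi v - Phi u = C * ((V v - V u) *
    ((A + V v) ^+ 2 + (A + V v) * (A + V u) + (A + V u) ^+ 2)).
  by rewrite /Phi -mulrBr cubeB; congr (_ * (_ * _)); ring.
have Phi_mono u v : I u -> I v -> u <= v -> Phi u <= Phi v.
  move=> Iu Iv uv; rewrite -subr_ge0 PhiB mulr_ge0// mulr_ge0 ?subr_ge0 ?Vmono//.
  by rewrite !addr_ge0 ?sqr_ge0// mulr_ge0// addr_ge0// V_ge0.
have Phi_ac b : I b -> ac_list 0 b (fun u v => Phi v - Phi u).
  (* Each of the three terms in the second factor of [PhiB] is at most [(A + V b) ^+ 2]. *)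
  move=> Ib; apply: (@ac_listW _ _ _ _ _ (C * (3 * (A + V b) ^+ 2)) _ _ (acV b Ib)).
    by rewrite mulr_ge0// mulr_ge0// sqr_ge0.
  move=> u v u0 uv vb; have Iv : I v by apply: Idown Ib _ vb; exact: le_trans uv.
  have Iu : I u by exact: Idown Iv _ uv.
  rewrite PhiB -mulrA ler_wpM2l// mulrC ler_wpM2r ?subr_ge0 ?Vmono//.
  have bu : A + V u <= A + V b by rewrite lerD2l Vmono// (le_trans uv).
  have bv : A + V v <= A + V b by rewrite lerD2l Vmono.
  have u0' : 0 <= A + V u by rewrite addr_ge0// V_ge0.
  have v0' : 0 <= A + V v by rewrite addr_ge0// V_ge0.
  have h1 : (A + V v) ^+ 2 <= (A + V b) ^+ 2 by rewrite lerXn2r ?nnegrE// (le_trans v0').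
  have h2 : (A + V u) ^+ 2 <= (A + V b) ^+ 2 by rewrite lerXn2r ?nnegrE// (le_trans u0').
  have h3 : (A + V v) * (A + V u) <= (A + V b) ^+ 2 by rewrite expr2 ler_pM.
  lra.
have [f [f1 f0 fint]] := locally_ac_density hI Phi_mono Phi_ac.
exists f; split => // s t u Is It Iu st tu.
apply: le_trans (fint _ _ It Iu tu); rewrite lee_fin.
have su := le_trans st tu; have s0 := Ige0 _ Is.
have [rst mst] := rhs _ (hU _ _ Is It st).
have [rsu msu] := rhs _ (hU _ _ Is Iu su).
have [_ mtu] := rhs _ (hU _ _ It Iu tu).
have [_ m0s] := rhs _ (hU _ _ I0 Is s0).
have [gsD] := TS (w 0 s z0) (wD _ _ _ I0 Is s0 z0D).
set Zs := T (w 0 s z0) => SZs.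
have Zs0 := gsD.
have x0s : complex.Re (T z0) <= complex.Re Zs by have := m0s _ Tz0; rewrite STz0.
have H : cmod (T (w s u z) - T (w s t z)) * (complex.Re Zs * complex.Re (T z)) <=
    cmod (T (w 0 u z0) - T (w 0 t z0)) * (cmod Zs + cmod (T z)) ^+ 2.
  have w0sD := wD _ _ _ I0 Is s0 z0D.
  have := right_half_self_increment rst rsu _ Zs0 Tz; rewrite /= STz SZs.
  rewrite -(hcomp 0 s u)// -(hcomp 0 s t)//; apply => y y0.
  have [SyD _] := ST y y0.
  rewrite (hcomp s t u)//.
  have [Twst STw] := TS _ (wD _ _ _ Is It st SyD).
  by have := mtu _ Twst; rewrite STw.
(* The orbit starts at [z0] because [w 0 0] is the identity, so [Zs] has moved from [T z0] by at
   most [V s]. *)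
have Zsle : cmod Zs <= cmod (T z0) + V t.
  have := dV 0 s I0 Is s0; rewrite hid// V0 subr0 -/Zs.
  have := cmodB_ge Zs (T z0); have := Vmono _ _ Is It st; lra.
have key : cmod (T (w s u z) - T (w s t z)) * (complex.Re (T z0) * complex.Re (T z)) <=
    (V u - V t) * (A + V t) ^+ 2.
  apply: (@le_trans _ _ (cmod (T (w s u z) - T (w s t z)) * (complex.Re Zs * complex.Re (T z)))).
    by rewrite ler_wpM2l ?cmod_ge0// ler_wpM2r// ltW.
  apply: le_trans H _; rewrite ler_pM ?cmod_ge0 ?sqr_ge0//; first exact: dV.
  rewrite lerXn2r ?nnegrE ?addr_ge0 ?cmod_ge0 ?V_ge0//; rewrite /A; lra.
have [wsuS wstS] : S (T (w s u z)) = w s u z /\ S (T (w s t z)) = w s t z.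
  by split; apply: (TS _ _).2; apply: wD.
rewrite -{1}wsuS -{1}wstS.
apply: le_trans (HL _ _ _ _) _.
- by have := msu _ Tz; rewrite STz.
- by have := mst _ Tz; rewrite STz.
rewrite PhiB /C mulrAC; set xx := complex.Re (T z0) * complex.Re (T z) in key *.
have xx0 : 0 < xx by rewrite mulr_gt0.
rewrite ler_pdivlMr// -mulrA ler_wpM2l//.
(* Of the three nonnegative terms in [PhiB], the last one, [(A + V t) ^+ 2], already suffices. *)
apply: le_trans key _; rewrite ler_wpM2l ?subr_ge0 ?Vmono//.
by rewrite lerDr addr_ge0 ?sqr_ge0// mulr_ge0// addr_ge0// V_ge0.
Qed.
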